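(* Let $G=(V,E)$ be a finite strongly connected directed graph on $n$ nodes with transition matrix $H$, and consider the pull voter model with agnostic nodes on $G$ with matrix $H$ and gnostic colours red and blue (either synchronous or asynchronous). Assume that the process converges for every starting configuration. Let $k$ be the number of agnostic vertices in the starting configuration. Then the (red) consensus probability from the starting configuration can be computed exactly in time $O(n^3 2^{3k})$ and with additional $O(n^2 2^{2k})$ memory, by solving a system of linear equations on $O(n2^k)$ variables.
   Context: Setting. $G=(V,E)$ is a finite strongly connected directed graph (self-loops allowed). The transition matrix $H$ is a row-stochastic $V\times V$ matrix with $H(v,u)>0$ if $(v,u)\in E$ and $H(v,u)=0$ otherwise. Time is counted in arithmetic operations and memory in stored numbers; the input is $H$ and the starting configuration. Pull voter model with agnostic nodes. Each node is, at each time, either agnostic (no colour) or gnostic; gnostic nodes are coloured red or blue. In the synchronous version, at each round every node $v$ independently selects an out-neighbour $u$ with probability $H(v,u)$. If $u$ is agnostic, $v$ keeps its current state; if $u$ is gnostic, $v$ copies the colour of $u$. All updates use the states at the start of the round and occur simultaneously. In the asynchronous version, at each round one node $v$ is chosen uniformly at random from $V$, it alone selects an out-neighbour (with probabilities $H(v,\cdot)$) and updates by the same rule; all other nodes keep their state. Red consensus means that a configuration in which all nodes are red is reached; the consensus probability is the probability of this event. The process converges for every starting configuration if, from every initial configuration with at least one gnostic node, with probability 1 a configuration in which all nodes have the same gnostic colour is eventually reached. *)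

(* Defs.v *)
From HB Require Import structures.
From mathcomp Require Import all_boot all_order all_algebra.
From mathcomp Require Import all_classical all_reals all_analysis.

Set Implicit Arguments.
Unset Strict Implicit.
Unset Printing Implicit Defensive.

Import Order.TTheory GRing.Theory Num.Theory.

Local Open Scope classical_set_scope.
Local Open Scope ring_scope.

(** * The pull voter model with agnostic nodes *)

Definition strongly_connected n (E : rel 'I_n) : Prop :=
  forall v u, connect E v u.

Definition transition_matrix (R : realType) n (E : rel 'I_n) (H : 'M[R]_n) :=
  [/\ forall v u, E v u -> 0 < H v u,
      forall v u, ~~ E v u -> H v u = 0
    & forall v, \sum_u H v u = 1].

(* [None] is agnostic, [Some true] is red and [Some false] is blue. *)
Definition config n := {ffun 'I_n -> option bool}.

Definition agnostic n (c : config n) : {set 'I_n} := [set v | c v == None]%SET.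

Definition consensus n (b : bool) : config n := [ffun=> Some b].

(* The state of [v] after it has selected the out-neighbour [u]. *)
Definition pull n (c : config n) (v u : 'I_n) : option bool :=
  if c u is Some b then Some b else c v.

Inductive mode := Synchronous | Asynchronous.

(* The random choices of one round: the out-neighbour selected by every node
   (synchronous), or the activated node with its selection (asynchronous). *)
Definition choices (m : mode) (n : nat) : finType :=
  match m with
  | Synchronous => {ffun 'I_n -> 'I_n}
  | Asynchronous => ('I_n * 'I_n)%type
  end.

Definition step (m : mode) n (c : config n) : choices m n -> config n :=
  match m return choices m n -> config n with
  | Synchronous => fun f => [ffun v => pull c v (f v)]
  | Asynchronous => fun a => [ffun v => if v == a.1 then pull c v a.2 else c v]
  end.

Definition choices_law (m : mode) (R : realType) n (H : 'M[R]_n) :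
    choices m n -> R :=
  match m return choices m n -> R with
  | Synchronous => fun f => \prod_v H v (f v)
  | Asynchronous => fun a => n%:R^-1 * H a.1 a.2
  end.

(* [xi t] is the outcome of a random experiment with law [law] at time [t],
   and the experiments at different times are mutually independent. *)
Definition iid_with_law d (T : measurableType d) (R : realType)
    (P : probability T R) (X : finType) (xi : nat -> T -> X) (law : X -> R) :=
  [/\ forall t x, measurable (xi t @^-1` [set x]),
      forall t x, P (xi t @^-1` [set x]) = (law x)%:E
    & forall (s : seq nat) (x : nat -> X), uniq s ->
        P (\bigcap_(t in [set` s]) (xi t @^-1` [set x t])) =
        (\prod_(t <- s) P (xi t @^-1` [set x t]))%E].

Fixpoint voter (m : mode) n T (xi : nat -> T -> choices m n) (c : config n)
    (t : nat) (w : T) : config n :=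
  if t is t'.+1 then step (voter xi c t' w) (xi t' w) else c.

Definition red_consensus_prob d (T : measurableType d) (R : realType)
    (P : probability T R) m n (xi : nat -> T -> choices m n) (c : config n) :=
  P [set w | exists t, voter xi c t w = consensus n true].

Definition converges d (T : measurableType d) (R : realType)
    (P : probability T R) m n (xi : nat -> T -> choices m n) : Prop :=
  forall c : config n, (exists v, c v != None) ->
    P [set w | exists t b, voter xi c t w = consensus n b] = 1%E.

(** * A real random-access machine *)

(* Two unbounded work memories, one of natural numbers (counters, addresses)
   and one of real numbers, with indirect addressing, and a read-only input:
   the number [n] of nodes, the matrix [H] and the starting configuration.
   Programs mention neither the field nor [n], so that a single program treats
   all instances; loops are bounded, hence execution always terminates. *)

Inductive nexp :=
  | NConst of nat
  | NNodes
  | NState of nexp  (* state of a node: 0 agnostic, 1 red, 2 blue *)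
  | NLoad of nexp
  | NAdd of nexp & nexp
  | NSub of nexp & nexp  (* truncated *)
  | NMul of nexp & nexp
  | NDiv of nexp & nexp
  | NMod of nexp & nexp.

Inductive rexp :=
  | RConst of nat
  | RMatrix of nexp & nexp
  | RLoad of nexp
  | RAdd of rexp & rexp
  | RSub of rexp & rexp
  | RMul of rexp & rexp
  | RDiv of rexp & rexp.

Inductive test :=
  | NLe of nexp & nexp
  | RLe of rexp & rexp
  | Not of test
  | And of test & test.

Inductive cmd :=
  | Skip
  | NStore of nexp & nexp  (* address, value *)
  | RStore of nexp & rexp  (* address, value *)
  | Seq of cmd & cmd
  | If of test & cmd & cmd
  | For of nexp & nexp & cmd.  (* counter address, number of iterations *)

Fixpoint nsize (e : nexp) : nat :=
  match e with
  | NConst _ | NNodes => 1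
  | NState a | NLoad a => (nsize a).+1
  | NAdd a b | NSub a b | NMul a b | NDiv a b | NMod a b =>
      (nsize a + nsize b).+1
  end%N.

Fixpoint rsize (e : rexp) : nat :=
  match e with
  | RConst _ => 1
  | RMatrix a b => (nsize a + nsize b).+1
  | RLoad a => (nsize a).+1
  | RAdd a b | RSub a b | RMul a b | RDiv a b => (rsize a + rsize b).+1
  end%N.

Fixpoint tsize (e : test) : nat :=
  match e with
  | NLe a b => (nsize a + nsize b).+1
  | RLe a b => (rsize a + rsize b).+1
  | Not a => (tsize a).+1
  | And a b => (tsize a + tsize b).+1
  end%N.

(* [elapsed] counts every elementary operation, on reals and on naturals alike.
   [footprint] bounds the number of cells written in either memory as well as the
   naturals stored, so that a natural only ever serves as an address-sized
   word and cannot encode an unbounded amount of data. *)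
Record machine (R : realType) := Machine {
  nmem : nat -> nat;
  rmem : nat -> R;
  elapsed : nat;
  footprint : nat }.

Definition machine0 (R : realType) : machine R :=
  Machine (fun=> 0%N) (fun=> 0) 0 0.

Section Execution.
Variables (R : realType) (n : nat) (H : 'M[R]_n) (c : config n).
Implicit Types s : machine R.

Definition input_state (i : nat) : nat :=
  if insub i is Some v then
    match c v with None => 0%N | Some true => 1%N | Some false => 2%N end
  else 0%N.

Definition input_matrix (i j : nat) : R :=
  match insub i, insub j with Some v, Some u => H v u | _, _ => 0 end.

Fixpoint neval s (e : nexp) : nat :=
  match e with
  | NConst z => z
  | NNodes => n
  | NState a => input_state (neval s a)
  | NLoad a => nmem s (neval s a)
  | NAdd a b => neval s a + neval s b
  | NSub a b => neval s a - neval s b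
  | NMul a b => neval s a * neval s b
  | NDiv a b => neval s a %/ neval s b
  | NMod a b => neval s a %% neval s b
  end%N.

Fixpoint reval s (e : rexp) : R :=
  match e with
  | RConst z => z%:R
  | RMatrix a b => input_matrix (neval s a) (neval s b)
  | RLoad a => rmem s (neval s a)
  | RAdd a b => reval s a + reval s b
  | RSub a b => reval s a - reval s b
  | RMul a b => reval s a * reval s b
  | RDiv a b => reval s a / reval s b
  end.

Fixpoint teval s (e : test) : bool :=
  match e with
  | NLe a b => (neval s a <= neval s b)%N
  | RLe a b => reval s a <= reval s b
  | Not a => ~~ teval s a
  | And a b => teval s a && teval s b
  end.

Definition upd X (f : nat -> X) (a : nat) (x : X) : nat -> X :=
  fun i => if i == a then x else f i.

Definition tick (z : nat) s : machine R :=
  Machine (nmem s) (rmem s) (elapsed s + z)%N (footprint s).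

Definition nwrite (a z : nat) s : machine R :=
  Machine (upd (nmem s) a z) (rmem s) (elapsed s)
          (maxn (footprint s) (maxn a.+1 z)).

Definition rwrite (a : nat) (x : R) s : machine R :=
  Machine (nmem s) (upd (rmem s) a x) (elapsed s) (maxn (footprint s) a.+1).

Fixpoint exec (p : cmd) s : machine R :=
  match p with
  | Skip => s
  | NStore a e =>
      tick (nsize a + nsize e).+1 (nwrite (neval s a) (neval s e) s)
  | RStore a e =>
      tick (nsize a + rsize e).+1 (rwrite (neval s a) (reval s e) s)
  | Seq p1 p2 => exec p2 (exec p1 s)
  | If b p1 p2 =>
      let s' := tick (tsize b).+1 s in
      if teval s b then exec p1 s' else exec p2 s'
  | For a e q =>
      let x := neval s a in
      foldl (fun s' i => exec q (tick 1 (nwrite x i s')))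
            (tick (nsize a + nsize e).+1 s) (iota 0 (neval s e))
  end.

End Execution.

(** * Linear systems *)

(* Layout of the square system [A *m x = b] in [N] unknowns: [N] in the first
   natural cell and the augmented matrix [A | b], row by row, at the beginning
   of the real memory. *)
Definition stores_system (R : realType) (s : machine R) N
    (A : 'M[R]_N) (b : 'cV[R]_N) : Prop :=
  [/\ nmem s 0 = N,
      forall i j : 'I_N, rmem s (i * N.+1 + j)%N = A i j
    & forall i : 'I_N, rmem s (i * N.+1 + N)%N = b i 0].

Definition stores_vector (R : realType) (s : machine R) N
    (x : 'cV[R]_N) : Prop :=
  forall i : 'I_N, rmem s i = x i 0.

(* The solver is a general-purpose subroutine: it has to be correct for every
   nonsingular system, whatever the rest of the memory and the input are. *)
Definition linear_solver (p : cmd) : Prop :=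
  forall (R : realType) n (H : 'M[R]_n) (c : config n) (s : machine R) N
         (A : 'M[R]_N) (b : 'cV[R]_N),
    A \in unitmx -> stores_system s A b ->
    exists x : 'cV[R]_N, A *m x = b /\ stores_vector (exec H c p s) x.

(* Main.v *)
Require Import Defs.
From mathcomp Require Import all_boot all_order all_algebra.
From mathcomp Require Import all_classical all_reals all_analysis.
From mathcomp Require Import zify ring lra.
From mathcomp Require Import fintype finset.

Set Implicit Arguments.
Unset Strict Implicit.
Unset Printing Implicit Defensive.

Import Order.TTheory GRing.Theory Num.Theory.
Import numFieldNormedType.Exports.

Local Open Scope ring_scope.

(* Let [x S v] be the probability that the colour of [v] eventually takes over
   when [S] is the set of agnostic nodes.  The set of agnostic nodes shrinks
   independently of the colours, so conditioning on the first round gives linear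
   equations between the [x S v] with [S] included in the initial agnostic set
   [A]: these are [n * 2 ^ k] unknowns, plus one for the answer, the sum of
   [x A v] over the red nodes [v].

   The equations of the layer [S = set0] say that [x set0] is stationary; they
   are redundant and one of them is replaced by [\sum_v x set0 v = 1].  The
   resulting system is nonsingular: a solution of the homogeneous system
   vanishes on the layer [set0] by Perron-Frobenius, and on every other layer by
   induction on the size of [S], because by strong connectivity some node of [S]
   has an out-neighbour outside [S], so that [S] shrinks with positive
   probability.  Conversely, for the solution [x], the sum of [x S v] over the
   red nodes [v] of the current configuration is a bounded martingale with value
   1 at red and 0 at blue consensus, hence its initial value is the red consensus
   probability.

   The transition coefficients factor over the nodes (a product in the
   synchronous case, a sum of products in the asynchronous one), so that after
   tabulating the agnostic masses [\sum_(y in S) H w y] each of them is computed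
   in [O(n)] operations; Gauss-Jordan elimination then dominates the cost. *)

(** * Colour provenance: the node from which each colour is inherited in one round *)

Section Provenance.
Variables (n : nat) (m : mode).
Implicit Types (S : {set 'I_n}) (u v w y : 'I_n) (c : config n).

Definition idle_source S w : option 'I_n := if w \in S then None else Some w.

Definition pull_source S w y : option 'I_n :=
  if y \in S then idle_source S w else Some y.

(* The node whose colour [w] carries after one round, [S] being the set of
   agnostic nodes; it does not depend on the colours. *)
Definition source S : choices m n -> 'I_n -> option 'I_n :=
  match m return choices m n -> 'I_n -> option 'I_n with
  | Synchronous => fun f w => pull_source S w (f w)
  | Asynchronous => fun a w =>
      if w == a.1 then pull_source S w a.2 else idle_source S w
  end.

Definition uncoloured S (a : choices m n) : {set 'I_n} :=
  [set w | source S a w == None]%SET.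

(** Both modes reduce to one formula: the new configuration is the old one read through [source].
    All later arguments on rounds can thus ignore the mode. *)
Lemma stepE c (a : choices m n) w :
  step c a w = obind c (source (agnostic c) a w).
Proof.
have pullE y : pull c w y = obind c (pull_source (agnostic c) w y).
  rewrite /pull /pull_source /idle_source !inE.
  case cy : (c y) => [b|] //=.
  by case cw : (c w).
have idleE : c w = obind c (idle_source (agnostic c) w).
  by rewrite /idle_source inE; case cw : (c w).
rewrite /source; case: m a => /= a; first by rewrite ffunE pullE.
by rewrite ffunE; case: ifP.
Qed.

Lemma source_notin S a u v : source S a u = Some v -> v \notin S.
Proof.
have idleP w : idle_source S w = Some v -> v \notin S.
  by rewrite /idle_source; case: ifPn => // wS [<-].
have pullP w y : pull_source S w y = Some v -> v \notin S.
  by rewrite /pull_source; case: ifPn => [_ /idleP //|yS [<-]].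
rewrite /source; case: m a => /= a; first exact: pullP.
by case: ifP => _; [exact: pullP | exact: idleP].
Qed.

Lemma agnostic_step c a : agnostic (step c a) = uncoloured (agnostic c) a.
Proof.
apply/setP => w; rewrite !inE stepE.
case e : (source _ a w) => [v|] //=.
by have := source_notin e; rewrite inE => /negbTE ->.
Qed.

(** A gnostic node never becomes agnostic again; this makes the linear system triangular with
    respect to inclusion of agnostic sets. *)
Lemma uncoloured_sub S a : uncoloured S a \subset S.
Proof.
have idleP w : idle_source S w == None -> w \in S by rewrite /idle_source; case: ifP.
have pullP w y : pull_source S w y == None -> w \in S.
  by rewrite /pull_source; case: ifP => // _; apply: idleP.
apply/subsetP => w; rewrite inE /source; case: m a => /= a; first exact: pullP.
by case: ifP => _; [exact: pullP | exact: idleP].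
Qed.

End Provenance.
Arguments source {n m}.
Arguments uncoloured {n m}.

(** * Transition coefficients of the linear equations *)

Section Coefficients.
Variables (R : realType) (n : nat) (E : rel 'I_n) (H : 'M[R]_n).
Hypotheses (n_gt0 : (0 < n)%N) (connE : strongly_connected E).
Hypothesis HP : transition_matrix E H.
Implicit Types (S : {set 'I_n}) (u v w y : 'I_n).

Lemma H_ge0 v u : 0 <= H v u.
Proof.
case: HP => pos zero _; case: (boolP (E v u)) => e; first exact/ltW/pos.
by rewrite zero.
Qed.

Lemma H_sum1 v : \sum_u H v u = 1. Proof. by case: HP. Qed.

Lemma law_ge0 m (a : choices m n) : 0 <= choices_law H a.
Proof.
case: m a => a /=; first by apply: prodr_ge0 => v _; exact: H_ge0.
by rewrite mulr_ge0 ?invr_ge0 ?ler0n ?H_ge0.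
Qed.

Lemma law_sum1 m : \sum_(a : choices m n) choices_law H a = 1.
Proof.
case: m => /=.
  rewrite -(bigA_distr_bigA (fun v u => H v u)) big1 // => v _; exact: H_sum1.
rewrite -(pair_bigA _ (fun v u => n%:R^-1 * H v u)) /=.
under eq_bigr => v _ do rewrite -mulr_sumr H_sum1 mulr1.
by rewrite sumr_const card_ord -[_ *+ n]mulr_natr mulVf // pnatr_eq0 -lt0n.
Qed.

(** Turns one edge into a whole round of positive probability. In the synchronous mode the other
    nodes select any out-neighbour of positive weight, which exists because every row of [H] sums to
    1. *)
Lemma select_pos m w y : 0 < H w y ->
  exists a : choices m n, 0 < choices_law H a /\
    forall S, source S a w = pull_source S w y.
Proof.
move=> Hwy.
have out v : exists u, 0 < H v u.
  apply: contrapT => no.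
  have := H_sum1 v; rewrite big1 => [/eqP|u _]; first by rewrite eq_sym oner_eq0.
  by apply/eqP; rewrite eq_le H_ge0 andbT leNgt; apply/negP => Hu; apply: no; exists u.
case: m => /=.
  exists [ffun v => if v == w then y else xchoose (out v)]; split=> [|S].
    apply: prodr_gt0 => v _; rewrite ffunE; case: eqP => [->//|_].
    exact: (xchooseP (out v)).
  by rewrite ffunE eqxx.
exists (w, y); split=> [|S] /=; last by rewrite eqxx.
by rewrite mulr_gt0 // invr_gt0 ltr0n.
Qed.

Section Transfer.
Variable m : mode.

(** Probability that a single round changes the agnostic set from [S] to [S'] and gives [u] the
    colour that [v] had. *)
Definition transfer S S' u v : R :=
  \sum_(a : choices m n)
    choices_law H a * ((uncoloured S a == S') && (source S a u == Some v))%:R.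

Lemma transfer_ge0 S S' u v : 0 <= transfer S S' u v.
Proof. by apply: sumr_ge0 => a _; rewrite mulr_ge0 ?law_ge0. Qed.

Lemma transfer_sub S S' u v : ~~ (S' \subset S) -> transfer S S' u v = 0.
Proof.
move=> nsub; apply: big1 => a _; case: eqP => [e|_]; last by rewrite mulr0.
by rewrite -e uncoloured_sub in nsub.
Qed.

Lemma transfer_in S S' u v : v \in S -> transfer S S' u v = 0.
Proof.
move=> vS; apply: big1 => a _; case: (source S a u =P Some v) => [e|_].
  by rewrite (negbTE (source_notin e)) in vS.
by rewrite andbF mulr0.
Qed.

(** In a given round [u] has at most one source, so the events for distinct [v] are disjoint. *)
Lemma transfer_sum_le S S' u : \sum_v transfer S S' u v <=
  \sum_(a : choices m n) choices_law H a * (uncoloured S a == S')%:R.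
Proof.
rewrite exchange_big /=; apply: ler_sum => a _.
rewrite -mulr_sumr ler_wpM2l ?law_ge0 //.
case: eqP => [_|_] /=; last by rewrite big1.
case: (source S a u) => [v|]; last by rewrite big1.
rewrite (bigD1 v) //= eqxx big1 ?addr0 // => i /negbTE ni.
by rewrite -(inj_eq Some_inj) eq_sym in ni; rewrite ni.
Qed.

(** Without agnostic nodes every node has exactly one source, and the agnostic set stays empty. *)
Lemma transfer_sum1 u : \sum_v transfer set0 set0 u v = 1.
Proof.
rewrite exchange_big -[RHS](law_sum1 m) /=; apply: eq_bigr => a _.
rewrite -mulr_sumr.
have -> : uncoloured set0 a = set0.
  by apply/eqP; rewrite -subset0 uncoloured_sub.
rewrite eqxx /=.
case e : (source set0 a u) => [v|].
  rewrite (bigD1 v) //= eqxx big1 ?addr0 ?mulr1 // => i /negbTE ni.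
  by rewrite -(inj_eq Some_inj) eq_sym in ni; rewrite ni.
have : u \in uncoloured set0 a by rewrite inE e.
by move/(subsetP (uncoloured_sub _ _)); rewrite inE.
Qed.

Lemma transfer_pos u v : E u v -> 0 < transfer set0 set0 u v.
Proof.
move=> Euv; have Huv : 0 < H u v by case: HP => + _ _; apply.
have [a [a0 aE]] := select_pos m Huv.
rewrite /transfer (bigD1 a) //= ltr_pwDl //.
  rewrite aE /pull_source inE eqxx andbT.
  have -> : uncoloured set0 a = set0.
    by apply/eqP; rewrite -subset0 uncoloured_sub.
  by rewrite eqxx mulr1.
by apply: sumr_ge0 => b _; rewrite mulr_ge0 ?law_ge0.
Qed.

(** A path from a node of [S] to a node outside [S] has a first edge that leaves [S]. *)
Lemma exit_edge S : S != set0 -> S != setT ->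
  exists w y, [/\ w \in S, y \notin S & E w y].
Proof.
move=> /set0Pn[w wS]; rewrite -subTset => /subsetPn[y _ yS].
have /connectP[p] := connE w y.
elim: p w wS => [|z p IH] w wS /=; first by move=> _ e; rewrite e wS in yS.
case/andP=> Ewz pz lz; case: (boolP (z \in S)) => zS; first exact: (IH z).
by exists w, z.
Qed.

(** A round in which the tail of an exit edge selects its head has positive probability and makes
    the tail gnostic. *)
Lemma stay_lt1 S : S != set0 -> S != setT ->
  \sum_(a : choices m n) choices_law H a * (uncoloured S a == S)%:R < 1.
Proof.
move=> S0 ST; have [w [y [wS yS Ewy]]] := exit_edge S0 ST.
have Hwy : 0 < H w y by case: HP => + _ _; apply.
have [a [a0 aE]] := select_pos m Hwy.
rewrite -[ltRHS](law_sum1 m) (bigD1 a) //= [ltRHS](bigD1 a) //=.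
have -> : (uncoloured S a == S) = false.
  apply: contraTF wS => /eqP <-.
  by rewrite inE aE /pull_source (negbTE yS).
rewrite mulr0 ltr_leD //; apply: ler_sum => b _.
by rewrite ler_piMr ?law_ge0 // lern1 leq_b1.
Qed.

(** * The linear system *)

Variables (A : {set 'I_n}) (v0 : 'I_n).

Definition balanced (x : {set 'I_n} -> 'I_n -> R) S v :=
  x S v = \sum_(S' : {set 'I_n} | S' \subset A) \sum_u transfer S S' u v * x S' u.

(** The equation at [(set0, v0)] is the one replaced by the normalization. The value [beta] is 1 for
    the system to be solved and 0 for its homogeneous version. *)
Definition layer_solution (x : {set 'I_n} -> 'I_n -> R) (beta : R) :=
  (forall S v, S \subset A -> (S, v) != (set0, v0) -> balanced x S v) /\
  \sum_u x set0 u = beta.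

Lemma sum_layer0 x v :
  \sum_(S' : {set 'I_n} | S' \subset A) \sum_u transfer set0 S' u v * x S' u =
  \sum_u transfer set0 set0 u v * x set0 u.
Proof.
rewrite (bigD1 set0) ?sub0set //= [X in _ + X]big1 ?addr0 // => S' /andP[_ S0].
by apply: big1 => u _; rewrite transfer_sub ?mul0r // subset0.
Qed.

(** By [transfer_sum1] the defects of the equations of the layer [set0] sum to 0, so the omitted
    equation follows from the others. *)
Lemma balanced0 x beta : layer_solution x beta ->
  forall S v, S \subset A -> balanced x S v.
Proof.
move=> [bal _] S v SA; case: (eqVneq (S, v) (set0, v0)) => [[-> ->]|]; last exact: bal.
rewrite /balanced sum_layer0.
have : \sum_v (x set0 v - \sum_u transfer set0 set0 u v * x set0 u) = 0.
  rewrite sumrB exchange_big /=; under [X in _ - X]eq_bigr => u _.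
    rewrite -mulr_suml transfer_sum1 mul1r; over.
  by rewrite subrr.
rewrite (bigD1 v0) //= [X in _ + X]big1 ?addr0 => [/subr0_eq //|w wv0].
have /bal : (set0, w) != (set0 : {set 'I_n}, v0) by rewrite xpair_eqE eqxx.
by move=> /(_ (sub0set _)); rewrite /balanced sum_layer0 => /eqP; rewrite -subr_eq0 => /eqP.
Qed.

(** Positivity propagates forward along edges, and strong connectivity lets it reach every node. *)
Lemma stationary_pos (y : 'I_n -> R) : (forall v, 0 <= y v) ->
  (forall v, y v = \sum_u transfer set0 set0 u v * y u) ->
  (exists v, y v != 0) -> forall v, 0 < y v.
Proof.
move=> y0 yE [v yv] w.
have {yv} : 0 < y v by rewrite lt_neqAle eq_sym yv y0.
have /connectP[p] := connE v w.
elim: p v => [|z p IH] v /=; first by move=> _ ->.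
case/andP=> Evz pz lz yv; apply: (IH z) => //; rewrite yE (bigD1 v) //=.
rewrite ltr_pwDl ?mulr_gt0 ?transfer_pos //.
by apply: sumr_ge0 => b _; rewrite mulr_ge0 ?transfer_ge0.
Qed.

(* Perron-Frobenius: [|y|], hence also [|y| + y] and [|y| - y], are stationary,
   and a nonnegative stationary vector is zero or positive everywhere. *)
Lemma stationary_sum0 (y : 'I_n -> R) :
  (forall v, y v = \sum_u transfer set0 set0 u v * y u) ->
  \sum_v y v = 0 -> forall v, y v = 0.
Proof.
move=> yE ys.
have le v : `|y v| <= \sum_u transfer set0 set0 u v * `|y u|.
  rewrite {1}yE (le_trans (ler_norm_sum _ _ _)) //; apply: ler_sum => u _.
  by rewrite normrM ger0_norm ?transfer_ge0.
(* The defects of [le] are nonnegative and sum to 0 over all nodes, hence each of them vanishes. *)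
have absE v : `|y v| = \sum_u transfer set0 set0 u v * `|y u|.
  have : \sum_v (\sum_u transfer set0 set0 u v * `|y u| - `|y v|) = 0.
    rewrite sumrB exchange_big /=; under [X in X - _]eq_bigr => u _.
      rewrite -mulr_suml transfer_sum1 mul1r; over.
    by rewrite subrr.
  move/eqP; rewrite psumr_eq0 => [/allP/(_ v)|w _]; last by rewrite subr_ge0.
  by rewrite mem_index_enum => /(_ isT)/eqP/subr0_eq.
have comb (e : R) : `|e| = 1 -> (forall v, 0 < `|y v| + e * y v) \/
    (forall v, `|y v| + e * y v = 0).
  move=> e1; have ge v : 0 <= `|y v| + e * y v.
    have: - (e * y v) <= `|y v| by rewrite (le_trans (ler_norm _)) // normrN normrM e1 mul1r.
    lra.
  have E' v : `|y v| + e * y v = \sum_u transfer set0 set0 u v * (`|y u| + e * y u).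
    under eq_bigr => u _ do rewrite mulrDr mulrCA.
    by rewrite big_split /= -mulr_sumr -absE -yE.
  case: (pselect (exists v, `|y v| + e * y v != 0)) => [ex|no].
    by left; apply: stationary_pos.
  by right=> v; apply: contra_notP no => /eqP nv; exists v.
have pos_false (e : R) : (forall v, `|y v| = e * y v) -> forall v, y v = 0.
  move=> ye v; have : \sum_v `|y v| = 0.
    by under eq_bigr => u _ do rewrite ye; rewrite -mulr_sumr ys mulr0.
  move/eqP; rewrite psumr_eq0 // => /allP/(_ v).
  by rewrite mem_index_enum => /(_ isT); rewrite normr_eq0 => /eqP.
have [p|z] := comb 1 (normr1 _); last first.
  by apply: (pos_false (-1)) => v; have := z v; lra.
have [q|z] := comb (-1) (etrans (normrN _) (normr1 _)); last first.
  by apply: (pos_false 1) => v; have := z v; lra.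
(* In the remaining case both combinations are positive everywhere, yet one of them is zero at [v]
   according to the sign of [y v]. *)
move=> v; have := p v; have := q v.
by case: (ger0P (y v)) => h; lra.
Qed.

(** By strong induction on the size of [S] the smaller layers drop out of the equation. The empty
    layer is [stationary_sum0]; in the full layer no node can be a source; in between, the sum of
    the absolute values is contracted by the probability [q < 1] that [S] does not change. *)
Lemma layer_kernel x : layer_solution x 0 ->
  forall S v, S \subset A -> x S v = 0.
Proof.
move=> sol S; have [_ sum0] := sol; have bal := balanced0 sol.
have [k] := ubnP #|S|; elim: k S => // k IH S; rewrite ltnS => Sk v SA.
have xS w : x S w = \sum_u transfer S S u w * x S u.
  rewrite bal // (bigD1 S) //= [X in _ + X]big1 ?addr0 // => S' /andP[S'A neq].
  apply: big1 => u _; case: (boolP (S' \subset S)) => sub; last first.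
    by rewrite transfer_sub ?mul0r.
  rewrite IH ?mulr0 // (leq_trans _ Sk) // proper_card // properEneq neq.
  exact: sub.
have [S0|S0] := eqVneq S set0.
  by rewrite S0 in xS *; exact: stationary_sum0.
have [ST|ST] := eqVneq S setT.
  by rewrite xS big1 // => u _; rewrite transfer_in ?mul0r // ST inE.
have := stay_lt1 S0 ST; set q := \sum_(a : choices m n) _ => q1.
have le : \sum_v `|x S v| <= q * \sum_v `|x S v|.
  apply: (@le_trans _ _ (\sum_v \sum_u transfer S S u v * `|x S u|)).
    apply: ler_sum => w _; rewrite {1}xS (le_trans (ler_norm_sum _ _ _)) //.
    by apply: ler_sum => u _; rewrite normrM ger0_norm ?transfer_ge0.
  rewrite exchange_big mulr_sumr /=; apply: ler_sum => u _.
  by rewrite -mulr_suml ler_wpM2r // transfer_sum_le.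
have : \sum_v `|x S v| = 0.
  have : 0 <= \sum_v `|x S v| by rewrite sumr_ge0.
  by move: le; move: (\sum_v _) => t; nra.
move/eqP; rewrite psumr_eq0 // => /allP/(_ v).
by rewrite mem_index_enum => /(_ isT); rewrite normr_eq0 => /eqP.
Qed.

Definition potential (x : {set 'I_n} -> 'I_n -> R) (c : config n) :=
  \sum_(v | c v == Some true) x (agnostic c) v.

(** After exchanging the sums it suffices to fix a round. Then only the resulting agnostic set
    contributes, and each node that is red afterwards is counted once, at its red source. *)
Lemma potential_harmonic x beta : layer_solution x beta ->
  forall c : config n, agnostic c \subset A ->
  \sum_(a : choices m n) choices_law H a * potential x (step c a) =
  potential x c.
Proof.
move=> sol c cA; have bal := balanced0 sol.
rewrite /potential; under [RHS]eq_bigr => v _ do rewrite bal //.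
under [RHS]eq_bigr => v _.
  under eq_bigr => S' _.
    under eq_bigr => u _ do rewrite /transfer mulr_suml.
    rewrite exchange_big; over.
  rewrite exchange_big; over.
rewrite exchange_big /=; apply: eq_bigr => a _.
rewrite agnostic_step exchange_big /=.
set U := uncoloured _ a.
have UA : U \subset A := subset_trans (uncoloured_sub _ _) cA.
rewrite (bigD1 U) //= [X in _ + X]big1 ?addr0 => [|S' /andP[_ S'U]]; last first.
  apply: big1 => v _; apply: big1 => u _.
  by rewrite [U == S']eq_sym (negbTE S'U) mulr0 mul0r.
rewrite exchange_big mulr_sumr big_mkcond /=; apply: eq_bigr => u _.
rewrite stepE eqxx /=.
case: (source _ a u) => [v|] /=; last by rewrite big1 // => v _; rewrite mulr0 mul0r.
have other i : i != v -> choices_law H a * (Some v == Some i)%:R * x U u = 0.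
  by move=> iv; rewrite (inj_eq Some_inj) eq_sym (negbTE iv) mulr0 mul0r.
case: ifP => cv.
  rewrite (bigD1 v) //= eqxx mulr1 big1 ?addr0 // => i /andP[_ iv]; exact: other.
by rewrite big1 // => i ci; apply: other; apply: contraTneq ci => ->; rewrite cv.
Qed.

End Transfer.

(** * Factorization of the coefficients over the nodes *)

Section LocalFactors.
Variables (S S' : {set 'I_n}) (u v : 'I_n).

(** Local condition on the source [o] of [w]; its conjunction over all [w] is the event measured by
    [transfer] (see [admitsE]). Its expectation is [active] when [w] selects a neighbour, and its
    indicator is [still] when [w] is idle. *)
Definition admits w (o : option 'I_n) : bool :=
  ((o == None) == (w \in S')) && ((w == u) ==> (o == Some v)).

Definition active w : R := \sum_y H w y * (admits w (pull_source S w y))%:R.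

Definition still w : bool := admits w (idle_source S w).

Definition agnostic_mass w : R := \sum_(y in S) H w y.

Lemma admitsE m (a : choices m n) :
  (uncoloured S a == S') && (source S a u == Some v) =
  [forall w, admits w (source S a w)].
Proof.
apply/andP/forallP => [[/eqP US' su] w|all].
  by rewrite /admits -US' inE eqxx /=; apply/implyP => /eqP ->.
split; last by have /andP[_ /implyP] := all u; apply.
by apply/eqP/setP => w; rewrite inE; have /andP[/eqP] := all w.
Qed.

Lemma forall_prod (P : pred 'I_n) : [forall w, P w]%:R = \prod_w (P w)%:R :> R.
Proof.
have [/forallP all|/forallPn[w nPw]] := boolP [forall w, P w].
  by rewrite big1 // => w _; rewrite all.
by rewrite (bigD1 w) //= (negbTE nPw) mul0r.
Qed.

(** The selections are independent, so the sum over joint choices of a product is a product of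
    sums. *)
Lemma transfer_sync : transfer Synchronous S S' u v = \prod_w active w.
Proof.
rewrite bigA_distr_bigA; apply: eq_bigr => f _.
by rewrite admitsE forall_prod -big_split.
Qed.

Lemma transfer_async : transfer Asynchronous S S' u v =
  n%:R^-1 * \sum_w active w * \prod_(w' | w' != w) (still w')%:R.
Proof.
rewrite mulr_sumr /transfer /=.
under [RHS]eq_bigr => w _ do rewrite mulr_suml mulr_sumr.
rewrite pair_bigA /=; apply: eq_bigr => -[w y] _ /=.
rewrite (admitsE (m := Asynchronous)) forall_prod (bigD1 w) //= eqxx !mulrA.
by congr (_ * _); apply: eq_bigr => w' /negbTE ->.
Qed.

(** Splitting the selection by membership in [S] leaves only [agnostic_mass] and one entry of [H],
    so each factor takes constant time once the masses are tabulated. *)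
Lemma activeE w : active w =
  if w == u then
    if w \in S' then 0 else
    (if v \in S then 0 else H w v) +
    (if w \in S then 0 else if w == v then agnostic_mass w else 0)
  else if w \in S then if w \in S' then agnostic_mass w else 1 - agnostic_mass w
  else if w \in S' then 0 else 1.
Proof.
have massE (F : pred 'I_n) : \sum_y H w y * (F y)%:R = \sum_(y in S) H w y * (F y)%:R +
    \sum_(y | y \notin S) H w y * (F y)%:R by rewrite (bigID (mem S)).
have compl : \sum_(y | y \notin S) H w y = 1 - agnostic_mass w.
  by rewrite -(H_sum1 w) [in RHS](bigID (mem S)) /= addrC addrK.
have inS (F : pred 'I_n) b : (forall y, y \in S -> F y = b) ->
    \sum_(y in S) H w y * (F y)%:R = if b then agnostic_mass w else 0.
  move=> Fb; under eq_bigr => y yS do rewrite Fb //.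
  by rewrite -mulr_suml; case: b {Fb}; rewrite ?mulr1 ?mulr0.
have outS (F : pred 'I_n) b : (forall y, y \notin S -> F y = b) ->
    \sum_(y | y \notin S) H w y * (F y)%:R = if b then 1 - agnostic_mass w else 0.
  move=> Fb; under eq_bigr => y yS do rewrite Fb //.
  by rewrite -mulr_suml compl; case: b {Fb}; rewrite ?mulr1 ?mulr0.
have oneS : \sum_(y | y \notin S) H w y * (Some y == Some v)%:R =
    if v \in S then 0 else H w v.
  case: ifP => vS.
    apply: big1 => y yS; rewrite (inj_eq Some_inj); case: eqP => [e|_]; last by rewrite mulr0.
    by rewrite e vS in yS.
  rewrite (bigD1 v) ?vS //= eqxx mulr1 big1 ?addr0 // => y /andP[_ /negbTE yv].
  by rewrite (inj_eq Some_inj) yv mulr0.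
rewrite /active massE /admits.
case: (w =P u) => [_|_] /=.
  case: ifP => wS'.
    rewrite (inS _ false) ?(outS _ false) ?addr0 // => y yS; rewrite /pull_source.
      by rewrite (negbTE yS).
    by rewrite yS /idle_source; case: ifP.
  have -> : \sum_(y | y \notin S) H w y * (((pull_source S w y == None) == false) &&
      (pull_source S w y == Some v))%:R = \sum_(y | y \notin S) H w y * (Some y == Some v)%:R.
    by apply: eq_bigr => y yS; rewrite /pull_source (negbTE yS).
  rewrite oneS addrC; congr (_ + _).
  rewrite (inS _ ((w \notin S) && (w == v))) => [|y yS].
    by case: (w \in S) => //=.
  rewrite /pull_source yS /idle_source; case: (w \in S) => //=.
under eq_bigr => y _ do rewrite andbT.
under [X in _ + X]eq_bigr => y _ do rewrite andbT.
rewrite (outS _ (w \notin S')) => [|y yS]; last first.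
  by rewrite /pull_source (negbTE yS); case: (w \in S').
rewrite (inS _ ((w \in S) == (w \in S'))) => [|y yS]; last first.
  by rewrite /pull_source yS /idle_source; case: (w \in S); case: (w \in S').
case: (w \in S) => /=; case: (w \in S') => /=; rewrite ?addr0 ?add0r //.
by rewrite addrC subrK.
Qed.

Lemma stillE w : still w =
  if w == u then [&& w \notin S', w \notin S & w == v]
  else (w \in S) == (w \in S').
Proof.
rewrite /still /admits /idle_source; case: (w == u) => /=.
  by case: (w \in S); case: (w \in S').
by case: (w \in S); rewrite andbT.
Qed.

End LocalFactors.
End Coefficients.

(** * Consensus probabilities *)

Section FiniteFibers.
Context d (T : measurableType d) (R : realType) (P : probability T R).

(** Law of total probability for the finite partition into fibres of [f]. *)
Lemma probability_fibers (Z : finType) (f : T -> Z) (B : set T) :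
  measurable B -> (forall z, measurable (f @^-1` [set z]%classic)) ->
  P B = (\sum_(z : Z) P (B `&` f @^-1` [set z]%classic)%classic)%E.
Proof.
move=> mB mf.
have {1}-> : B = (\bigcup_(z in [set` index_enum Z]) (B `&` f @^-1` [set z]))%classic.
  apply/seteqP; split => [w Bw|w [z _ []//]].
  by exists (f w) => //=; rewrite mem_index_enum.
rewrite measure_fin_bigcup //.
- rewrite -(@fsbig_seq _ _ _ _ (index_enum Z)) //; exact: index_enum_uniq.
- by move=> i j _ _ [w [[_ /= <-] [_ /= <-]]].
- by move=> z _; apply: measurableI.
Qed.

Lemma measurable_fibers (Z Z' : finType) (f : T -> Z) (g : Z -> Z') :
  (forall z, measurable (f @^-1` [set z]%classic)) ->
  forall z', measurable ((g \o f) @^-1` [set z']%classic).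
Proof.
move=> mf z'.
have -> : ((g \o f) @^-1` [set z'] =
    \bigcup_(z in [set z | g z = z']) (f @^-1` [set z]))%classic.
  by apply/seteqP; split => [w /= gf|w [z /= gz fz]]; [exists (f w) | rewrite fz].
by apply: fin_bigcup_measurable => //; exact: finite_finset.
Qed.

End FiniteFibers.

(** * Law of the configuration at time [t] and the limit of the expected potential *)

Section Voter.
Context (m : mode) (R : realType) (n : nat) (E : rel 'I_n) (H : 'M[R]_n)
  (d : measure_display) (T : measurableType d) (P : probability T R)
  (xi : nat -> T -> choices m n).
Hypotheses (n_gt0 : (0 < n)%N) (HP : transition_matrix E H).
Hypotheses (iid : iid_with_law P xi (choices_law H)) (conv : converges P xi).
Variable c : config n.

(** Forward recursion of the Markov chain, free of the probability space; [config_lawE] identifies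
    it with the law of [voter]. *)
Fixpoint config_law t (c' : config n) : R :=
  if t is t'.+1 then
    \sum_(z : config n * choices m n)
      config_law t' z.1 * choices_law H z.2 * (step z.1 z.2 == c')%:R
  else (c == c')%:R.

Let reached t c' : set T := voter xi c t @^-1` [set c']%classic.
Let draws (s : seq nat) (x : nat -> choices m n) : set T :=
  (\bigcap_(t in [set` s]) (xi t @^-1` [set x t]))%classic.

Let measurable_pair t :
  (forall c', measurable (reached t c')) ->
  forall z : config n * choices m n,
    measurable ((fun w => (voter xi c t w, xi t w)) @^-1` [set z]%classic).
Proof.
move=> mr [c' a]; have [mxi _ _] := iid.
have -> : ((fun w => (voter xi c t w, xi t w)) @^-1` [set (c', a)] =
   reached t c' `&` xi t @^-1` [set a])%classic.
  by apply/seteqP; split => [w [<- <-]|w [/= <- <-]].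
exact: measurableI.
Qed.

Let measurable_reached t c' : measurable (reached t c').
Proof.
elim: t c' => [|t IH] c'.
  rewrite /reached /=; case: (eqVneq c c') => [->|/eqP cc'].
    have -> : ((fun _ : T => c') @^-1` [set c'] = classical_sets.setT)%classic.
      by apply/seteqP; split.
    exact: measurableT.
  have -> : ((fun _ : T => c) @^-1` [set c'] = classical_sets.set0)%classic by apply/seteqP; split.
  exact: measurable0.
exact: (measurable_fibers (fun z => step z.1 z.2) (measurable_pair IH)).
Qed.

Let measurable_draws s x : measurable (draws s x).
Proof.
have [mxi _ _] := iid.
rewrite /draws classical_sets.bigcap_seq.
by elim/big_ind: _ => // *; exact: measurableI.
Qed.

(* The configuration at time [t] is independent of the draws from [t] on. *)
Lemma voter_draws t c' s x : uniq s -> all (leq t) s ->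
  P (reached t c' `&` draws s x)%classic =
  (config_law t c' * \prod_(i <- s) choices_law H (x i))%:E.
Proof.
have [mxi lawxi indxi] := iid.
elim: t c' s x => [|t IH] c' s x us ge.
  rewrite /reached /=; case: (eqVneq c c') => [->|/eqP cc'].
    have -> : ((fun _ : T => c') @^-1` [set c'] `&` draws s x = draws s x)%classic.
      by apply/seteqP; split=> w => [[]|].
    rewrite mul1r indxi // (eq_bigr (fun i => (choices_law H (x i))%:E)) => [|i _].
      by rewrite prodEFin.
    exact: lawxi.
  have -> : ((fun _ : T => c) @^-1` [set c'] `&` draws s x = classical_sets.set0)%classic.
    by apply/seteqP; split=> w [].
  by rewrite measure0 mul0r.
rewrite (probability_fibers _ _ (measurable_pair (measurable_reached t))); last first.
  exact: measurableI.
rewrite /= mulr_suml -sumEFin; apply: eq_bigr => -[c'' a] _ /=.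
have tns : t \notin s by apply/negP => /(allP ge); rewrite ltnn.
(* The draw [a] at time [t] joins the prescribed draws; there is no conflict because all times in
   [s] exceed [t]. *)
pose x' i := if i == t then a else x i.
have x'E i : i \in s -> x' i = x i.
  by move=> si; rewrite /x'; case: eqP => // ti; rewrite ti (negbTE tns) in si.
case: (eqVneq (step c'' a) c') => [sc|/eqP sc].
  have -> : (reached t.+1 c' `&` draws s x `&`
     (fun w => (voter xi c t w, xi t w)) @^-1` [set (c'', a)] =
     reached t c'' `&` draws (t :: s) x')%classic.
    apply/seteqP; split=> w.
      move=> [[_ dr] [/= cw aw]]; split=> // i /=; rewrite inE => /orP[/eqP ->|si].
        by rewrite /x' eqxx.
      by rewrite x'E //; exact: dr.
    move=> [/= cw dr]; have aw : xi t w = a.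
      by have := dr t (mem_head _ _); rewrite /x' /= eqxx.
    split; last by rewrite /= aw cw.
    split; first by rewrite /reached /= aw cw.
    by move=> i si; rewrite /= -x'E //; apply: dr; rewrite /= inE si orbT.
  rewrite IH /= ?us ?tns ?leqnn //; last first.
    by apply/allP => i /(allP ge) /ltnW.
  rewrite big_cons {1}/x' eqxx mulr1 -mulrA; congr (_ * (_ * _))%:E.
  by apply: eq_big_seq => i si; rewrite x'E.
have -> : (reached t.+1 c' `&` draws s x `&`
     (fun w => (voter xi c t w, xi t w)) @^-1` [set (c'', a)] = classical_sets.set0)%classic.
  apply/seteqP; split=> w // [[/= rc _] [cw aw]]; apply: sc.
  by move: rc; rewrite /reached /= cw aw.
by rewrite measure0 mulr0 mul0r.
Qed.

Lemma config_lawE t c' : P (reached t c') = (config_law t c')%:E.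
Proof.
(* An empty list of times imposes no condition; [xi 0 point] merely provides some element of
   [choices m n]. *)
have := @voter_draws t c' [::] (fun=> xi 0 point) isT isT.
rewrite big_nil mulr1 => <-; congr (P _).
by apply/seteqP; split=> w => [rw|[]//]; split.
Qed.

Lemma config_law_ge0 t c' : 0 <= config_law t c'.
Proof. by rewrite -lee_fin -config_lawE. Qed.

Lemma config_law_sum1 t : \sum_c' config_law t c' = 1.
Proof.
apply: EFin_inj; rewrite -sumEFin -(@probability_setT _ _ _ P).
rewrite (@probability_fibers _ _ _ P _ (voter xi c t)) //; last exact: measurable_reached.
by apply: eq_bigr => c' _; rewrite classical_sets.setTI -config_lawE.
Qed.

(** Agnostic sets only shrink, so the chain stays where [potential_harmonic] applies. *)
Lemma config_law_agnostic t c' :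
  ~~ (agnostic c' \subset agnostic c) -> config_law t c' = 0.
Proof.
elim: t c' => [|t IH] c' /= sub.
  by case: eqP => // cc'; rewrite cc' subxx in sub.
apply: big1 => -[c'' a] _ /=; case: eqP => [sc|_]; last by rewrite mulr0.
rewrite IH ?mul0r //; apply: contra sub => /(subset_trans _); apply.
by rewrite -sc agnostic_step uncoloured_sub.
Qed.

Lemma expected_potential v0 x beta t :
  layer_solution H m (agnostic c) v0 x beta ->
  \sum_c' config_law t c' * potential x c' = potential x c.
Proof.
move=> sol; elim: t => [|t IH] /=.
  rewrite (bigD1 c) //= eqxx mul1r big1 ?addr0 // => c' /negbTE.
  by rewrite eq_sym => ->; rewrite mul0r.
rewrite -IH; under eq_bigr => c' _ do rewrite mulr_suml.
rewrite exchange_big /= -(pair_bigA _ (fun c'' a => \sum_c'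
  config_law t c'' * choices_law H a * (step c'' a == c')%:R * potential x c')) /=.
apply: eq_bigr => c'' _.
case: (boolP (agnostic c'' \subset agnostic c)) => sub; last first.
  rewrite config_law_agnostic // mul0r big1 // => a _.
  by rewrite big1 // => c' _; rewrite !mul0r.
rewrite -(potential_harmonic n_gt0 HP sol sub) mulr_sumr; apply: eq_bigr => a _.
rewrite (bigD1 (step c'' a)) //= eqxx mulr1 mulrA big1 ?addr0 // => c' /negbTE.
by rewrite eq_sym => ->; rewrite mulr0 mul0r.
Qed.

Lemma potential_consensus (x : {set 'I_n} -> 'I_n -> R) b :
  potential x (consensus n b) = if b then \sum_u x set0 u else 0.
Proof.
rewrite /potential; have -> : agnostic (consensus n b) = set0.
  by apply/setP => v; rewrite !inE ffunE.
by case: b; [apply: eq_bigl|apply: big_pred0] => v; rewrite ffunE.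
Qed.

Lemma consensus_absorbing b t w : voter xi c t w = consensus n b ->
  voter xi c t.+1 w = consensus n b.
Proof.
move=> /= ->; apply/ffunP => v; rewrite stepE ffunE.
case e : (source _ _ v) => [u|] /=; first by rewrite ffunE.
have : v \in uncoloured (agnostic (consensus n b)) (xi t w) by rewrite inE e.
by move/(subsetP (uncoloured_sub _ _)); rewrite inE ffunE.
Qed.

Lemma voter_stays b t t' w : (t <= t')%N -> voter xi c t w = consensus n b ->
  voter xi c t' w = consensus n b.
Proof.
move=> /subnKC <- ct; elim: (t' - t)%N => [|i IH]; first by rewrite addn0.
by rewrite addnS; exact: consensus_absorbing.
Qed.

Lemma consensus_neq : consensus n true != consensus n false.
Proof. by apply/eqP => /ffunP/(_ (Ordinal n_gt0)); rewrite !ffunE. Qed.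

(** The expected potential is constant in time. At time [t] it differs from the probability of red
    consensus by at most a constant times the probability of no consensus yet, which tends to 0 by
    [conv]; the red probability increases to its limit by continuity from below. *)
Lemma red_consensus_potential v0 x :
  layer_solution H m (agnostic c) v0 x 1 ->
  (potential x c)%:E = red_consensus_prob P xi c.
Proof.
(* The assumption [conv] concerns configurations with a gnostic node. From an entirely agnostic one
   nothing ever changes, and both sides are 0. *)
move=> sol; case: (pselect (exists v, c v != None)) => [gnostic|no]; last first.
  have cN v : c v = None by apply: contra_notP no => /eqP cv; exists v.
  rewrite /potential big_pred0 => [|v]; last by rewrite cN.
  rewrite /red_consensus_prob.
  have -> : [set w | exists t, voter xi c t w = consensus n true]%classic = classical_sets.set0.
    apply/seteqP; split => [w [t]|//]; have -> : voter xi c t w = c.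
      elim: t => //= t ->; apply/ffunP => v; rewrite stepE.
      by case: (source _ _ v) => [u|] /=; rewrite !cN.
    by move=> cT; have := cN (Ordinal n_gt0); rewrite cT ffunE.
  by rewrite measure0.
set red := config_law^~ (consensus n true).
set blue := config_law^~ (consensus n false).
pose both t : set T := (reached t (consensus n true) `|` reached t (consensus n false))%classic.
have both_law t : P (both t) = (red t + blue t)%:E.
  rewrite EFinD -!config_lawE; apply: measureU => //.
  apply/seteqP; split => // w [/= e1 e2].
  by have := consensus_neq; rewrite -e1 -e2 eqxx.
have red_cvg : (red t @[t --> \oo] --> fine (red_consensus_prob P xi c))%classic.
  have -> : red = (fine \o (P \o (fun t => reached t (consensus n true)))).
    by apply/funext => t /=; rewrite config_lawE.
  have U : [set w | exists t, voter xi c t w = consensus n true]%classic =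
      (\bigcup_t reached t (consensus n true))%classic.
    by apply/seteqP; split => [w [t tw]|w [t _ tw]]; exists t.
  apply: fine_cvg; rewrite /red_consensus_prob U.
  rewrite fineK ?fin_num_measure //; last exact: bigcupT_measurable.
  apply: nondecreasing_cvg_mu => //; first exact: bigcupT_measurable.
  by move=> t t' tt'; apply/subsetPset => w; exact: voter_stays.
have both_cvg : ((red t + blue t) @[t --> \oo] --> (1 : R))%classic.
  have -> : (fun t => red t + blue t) = (fine \o (P \o both)).
    by apply/funext => t /=; rewrite both_law.
  have U : [set w | exists t b, voter xi c t w = consensus n b]%classic =
      (\bigcup_t both t)%classic.
    apply/seteqP; split => [w [t [[] tw]]|w [t _ [] tw]]; [| |by exists t, true|by exists t, false].
      by exists t => //; left.
    by exists t => //; right.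
  apply: fine_cvg; rewrite -(conv gnostic) U.
  have mb t : measurable (both t) by apply: measurableU.
  apply: nondecreasing_cvg_mu => //; first exact: bigcupT_measurable.
  by move=> t t' tt'; apply/subsetPset => w [] tw; [left|right]; exact: voter_stays tw.
pose bound := \sum_c' `|potential x c'|.
(* The potential is 1 at red and 0 at blue consensus, so the difference is the expectation over the
   other configurations. *)
have close t : `|potential x c - red t| <= bound * (1 - (red t + blue t)).
  have := expected_potential t sol.
  have := config_law_sum1 t.
  rewrite (bigD1 (consensus n true)) //= [in X in _ -> X](bigD1 (consensus n true)) //=.
  rewrite (bigD1 (consensus n false)) ?(eq_sym _ (consensus n true)) ?consensus_neq //=.
  rewrite [in X in _ -> X](bigD1 (consensus n false)) ?(eq_sym _ (consensus n true)) ?consensus_neq //=.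
  have [_ s1] := sol; rewrite !potential_consensus s1 mulr1 mulr0 add0r.
  move=> sum1 <-; rewrite [X in `|X|]addrAC subrr add0r.
  have -> : 1 - (red t + blue t) = \sum_(c' | (c' != consensus n true) &&
      (c' != consensus n false)) config_law t c'.
    by rewrite -sum1 addrA [X in X - _]addrC addrK.
  rewrite (le_trans (ler_norm_sum _ _ _)) // mulr_sumr; apply: ler_sum => c' _.
  rewrite normrM ger0_norm ?config_law_ge0 // mulrC ler_wpM2r ?config_law_ge0 //.
  by rewrite /bound (bigD1 c') //= lerDl sumr_ge0.
have diff_cvg : ((potential x c - red t) @[t --> \oo] --> (0 : R))%classic.
  apply/norm_cvg0P; apply: (@squeeze_cvgr _ _ _ _ (fun=> 0)
    (fun t => bound * (1 - (red t + blue t)))).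
  - by apply: nearW => t; rewrite normr_ge0 close.
  - exact: cvg_cst.
  - rewrite -[X in (_ --> X)%classic](mulr0 bound) -(subrr (1 : R)).
    by apply: cvgM; [exact: cvg_cst|apply: cvgB => //; exact: cvg_cst].
have red_cvg' : (red t @[t --> \oo] --> potential x c)%classic.
  rewrite -[X in (_ --> X)%classic]subr0.
  have -> : red = (fun t => potential x c - (potential x c - red t)).
    by apply/funext => t; rewrite subKr.
  by apply: cvgB => //; exact: cvg_cst.
rewrite (cvg_unique (@norm_hausdorff _ _) red_cvg' red_cvg) fineK //.
rewrite fin_num_measure //.
have -> : [set w | exists t, voter xi c t w = consensus n true]%classic =
      (\bigcup_t reached t (consensus n true))%classic.
  by apply/seteqP; split => [w [t tw]|w [t _ tw]]; exists t.
exact: bigcupT_measurable.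
Qed.

End Voter.

(** * Reasoning on programs *)

(** Conservative syntactic criterion: a store of a natural at a computed address counts as touching
    every cell. *)
Fixpoint keeps (a : nat) (p : cmd) : bool :=
  match p with
  | Skip | RStore _ _ => true
  | NStore (NConst b) _ => a != b
  | Seq p1 p2 | If _ p1 p2 => keeps a p1 && keeps a p2
  | For (NConst b) _ q => (a != b) && keeps a q
  | _ => false
  end.

Fixpoint ubound (n U : nat) (e : nexp) : nat :=
  match e with
  | NConst z => z
  | NNodes => n
  | NState _ => 2
  | NLoad _ => U
  | NAdd a b => ubound n U a + ubound n U b
  | NMul a b => ubound n U a * ubound n U b
  | NSub a _ | NDiv a _ | NMod a _ => ubound n U a
  end%N.

(** Stores of naturals are rejected, so loop counters are the only naturals written. At most [U.+1]
    iterations keep these counters at most [U]. *)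
Fixpoint bounded (n U F : nat) (p : cmd) : Prop :=
  match p with
  | Skip => True
  | RStore a _ => (ubound n U a < F)%N
  | Seq p1 p2 | If _ p1 p2 => bounded n U F p1 /\ bounded n U F p2
  | For (NConst b) e q =>
      [/\ (ubound n U e <= U.+1)%N, (b < F)%N, (U <= F)%N & bounded n U F q]
  | _ => False
  end.

(** Constant factor in the running time [weight p * U.+1 ^ depth p]; both branches of a test are
    charged. *)
Fixpoint weight (p : cmd) : nat :=
  match p with
  | Skip => 0
  | NStore a e => (nsize a + nsize e).+1
  | RStore a e => (nsize a + rsize e).+1
  | Seq p1 p2 => weight p1 + weight p2
  | If b p1 p2 => (Defs.tsize b).+1 + (weight p1 + weight p2)
  | For a e q => (nsize a + nsize e).+1 + (1 + weight q)
  end%N.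

Fixpoint depth (p : cmd) : nat :=
  match p with
  | Seq p1 p2 | If _ p1 p2 => maxn (depth p1) (depth p2)
  | For _ _ q => (depth q).+1
  | _ => 0
  end%N.

Section Programs.
Variables (R : realType) (n : nat) (H : 'M[R]_n) (c : config n).
Implicit Types (s : machine R) (p q : cmd).

(** Invariant rule for loops; counter address and number of iterations are evaluated once, at the
    start. *)
Lemma for_ind (I : nat -> machine R -> Prop) a e q s :
  I 0%N (tick (nsize a + nsize e).+1 s) ->
  (forall i s', (i < neval c s e)%N -> I i s' ->
     I i.+1 (exec H c q (tick 1 (nwrite (neval c s a) i s')))) ->
  I (neval c s e) (exec H c (For a e q) s).
Proof.
rewrite /=; move: (neval c s a) (neval c s e) => x k; move: (tick _ s) => s0.
suff loop i j s1 : (i + j = k)%N -> I i s1 ->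
    (forall i s', (i < k)%N -> I i s' -> I i.+1 (exec H c q (tick 1 (nwrite x i s')))) ->
    I k (foldl (fun s' i => exec H c q (tick 1 (nwrite x i s'))) s1 (iota i j)).
  by move=> I0 IS; apply: loop.
move=> + + IS; elim: j i s1 => [|j IH] i s1 ij Ii /=.
  by rewrite -ij addn0.
apply: IH; first by rewrite addSnnS.
by apply: IS => //; rewrite -ij addnS ltnS leq_addr.
Qed.

Lemma keeps_exec a p s : keeps a p -> nmem (exec H c p s) a = nmem s a.
Proof.
elim: p s => //=.
- by move=> [] // b e s ab; rewrite /= /upd (negbTE ab).
- by move=> p1 IH1 p2 IH2 s /andP[k1 k2]; rewrite IH2 // IH1.
- by move=> b p1 IH1 p2 IH2 s /andP[k1 k2]; case: ifP => _; rewrite ?IH1 ?IH2.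
- move=> [] // b e q IH s /andP[ab kq].
  apply: (@for_ind (fun _ s' => nmem s' a = nmem s a) (NConst b) e q s) => // i s' _ e'.
  by rewrite IH //= /upd (negbTE ab).
Qed.

(** Variant for invariants on the real memory alone: the frame condition on natural cells is
    supplied by [keeps]. *)
Lemma for_rmem (I : nat -> (nat -> R) -> Prop) b e q s :
  I 0%N (rmem s) ->
  (forall i s', (i < neval c s e)%N -> nmem s' b = i ->
     (forall a, keeps a (For (NConst b) e q) -> nmem s' a = nmem s a) ->
     I i (rmem s') -> I i.+1 (rmem (exec H c q s'))) ->
  I (neval c s e) (rmem (exec H c (For (NConst b) e q) s)).
Proof.
move=> I0 IS.
pose J i s' := I i (rmem s') /\
  forall a, keeps a (For (NConst b) e q) -> nmem s' a = nmem s a.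
suff [] : J (neval c s e) (exec H c (For (NConst b) e q) s) by [].
apply: (@for_ind J) => // i s' ik [Ii fr].
have fr' a : keeps a (For (NConst b) e q) ->
    nmem (tick 1 (nwrite (neval c s (NConst b)) i s')) a = nmem s a.
  by move=> ka; rewrite /= /upd -fr //; move: ka => /= /andP[/negbTE -> _].
split; first by apply: IS => //=; rewrite /upd eqxx.
move=> a ka; rewrite -fr' // keeps_exec //.
by move: ka => /= /andP[].
Qed.

Lemma input_state_le2 i : (input_state c i <= 2)%N.
Proof. by rewrite /input_state; case: insub => // v; case: (c v) => // -[]. Qed.

Lemma neval_ubound U s e :
  (forall a, nmem s a <= U)%N -> (neval c s e <= ubound n U e)%N.
Proof.
move=> sU; elim: e => //=.
- by move=> e _; exact: input_state_le2.
- by move=> a IHa b IHb; exact: leq_add.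
- by move=> a IHa b IHb; rewrite (leq_trans (leq_subr _ _)).
- by move=> a IHa b IHb; exact: leq_mul.
- by move=> a IHa b IHb; rewrite (leq_trans (leq_div _ _)).
- by move=> a IHa b IHb; rewrite (leq_trans (leq_mod _ _)).
Qed.

Lemma bounded_exec U F p s : bounded n U F p -> (forall a, nmem s a <= U)%N ->
  [/\ forall a, (nmem (exec H c p s) a <= U)%N,
      (footprint (exec H c p s) <= maxn (footprint s) F)%N
    & (elapsed (exec H c p s) <= elapsed s + weight p * U.+1 ^ depth p)%N].
Proof.
have grow a k l : (k <= l)%N -> (a * U.+1 ^ k <= a * U.+1 ^ l)%N.
  by move=> kl; rewrite leq_mul2l leq_pexp2l ?orbT.
elim: p s => //=.
- by move=> s _ sU; split=> //; rewrite ?leq_maxl ?leq_addr.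
- move=> a e s aF sU; split=> //=; last by rewrite expn0 muln1.
  by rewrite geq_max leq_maxl (leq_trans _ (leq_maxr _ _)) // (leq_ltn_trans _ aF) // neval_ubound.
- move=> p1 IH1 p2 IH2 s [b1 b2] sU.
  have [u1 f1 e1] := IH1 s b1 sU; have [u2 f2 e2] := IH2 _ b2 u1.
  split=> //; first by rewrite (leq_trans f2) // geq_max f1 leq_maxr.
  rewrite (leq_trans e2) // mulnDl addnA leq_add ?grow ?leq_maxr //.
  by rewrite (leq_trans e1) // leq_add2l grow // leq_maxl.
- move=> b p1 IH1 p2 IH2 s [b1 b2] sU.
  have tk : (Defs.tsize b < (Defs.tsize b).+1 * U.+1 ^ maxn (depth p1) (depth p2))%N.
    by rewrite leq_pmulr // expn_gt0.
  case: ifP => _.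
    have [u1 f1 e1] := IH1 (tick (Defs.tsize b).+1 s) b1 sU; split=> //.
    rewrite (leq_trans e1) //= -addnA leq_add2l mulnDl leq_add // mulnDl.
    by rewrite (leq_trans _ (leq_addr _ _)) // grow // leq_maxl.
  have [u1 f1 e1] := IH2 (tick (Defs.tsize b).+1 s) b2 sU; split=> //.
  rewrite (leq_trans e1) //= -addnA leq_add2l mulnDl leq_add // mulnDl.
  by rewrite (leq_trans _ (leq_addl _ _)) // grow // leq_maxr.
- move=> [] // b e q IH s [eU bF UF bq] sU.
  set t := (nsize (NConst b) + nsize e).+1.
  pose I i s' := [/\ forall a, (nmem s' a <= U)%N,
    (footprint s' <= maxn (footprint s) F)%N
    & (elapsed s' <= elapsed s + t + i * (1 + weight q * U.+1 ^ depth q))%N].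
  have : I (neval c s e) (exec H c (For (NConst b) e q) s).
    apply: for_ind => [|i s' ik [u f el]].
      by split=> //=; rewrite ?leq_maxl ?addn0.
    have iU : (i <= U)%N.
      by rewrite -ltnS (leq_trans ik) // (leq_trans (neval_ubound _ sU)).
    have [|u1 f1 e1] := IH (tick 1 (nwrite b i s')) bq.
      by move=> a /=; rewrite /upd; case: eqP.
    split=> //.
      rewrite (leq_trans f1) //= geq_max leq_maxr andbT geq_max f /=.
      by rewrite (leq_trans _ (leq_maxr _ _)) // geq_max bF (leq_trans iU).
    rewrite (leq_trans e1) //= mulSn.
    rewrite [X in (_ <= X)%N]addnA [X in (_ <= X)%N]addnAC.
    by rewrite [X in (_ <= X)%N]addnA leq_add2r leq_add2r.
  case=> u f el; split=> //; rewrite (leq_trans el) // -addnA leq_add2l.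
  rewrite mulnDl leq_add // ?leq_pmulr ?expn_gt0 //.
  have le_k : (neval c s e <= U.+1)%N by rewrite (leq_trans (neval_ubound _ sU)).
  rewrite (leq_trans (leq_mul le_k (leqnn _))) // expnS mulnCA leq_mul2l /= mulnDl mul1n leq_add2r.
  by rewrite expn_gt0.
Qed.

End Programs.

(** * Gauss-Jordan elimination *)

Definition var (a : nat) : nexp := NLoad (NConst a).
Definition width : nexp := NAdd (var 0) (NConst 1).
Definition entry (i j : nexp) : nexp := NAdd (NMul i width) j.
(* The first real cell after the augmented matrix. *)
Definition free_cell : nexp := NMul (var 0) width.

(** The multiplier is read from [free_cell], because the entries from which it is computed may be
    overwritten during the loop. *)
Definition add_row (p q : nat) : cmd :=
  For (NConst 3) width
    (RStore (entry (var p) (var 3))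
      (RAdd (RLoad (entry (var p) (var 3)))
            (RMul (RLoad free_cell) (RLoad (entry (var q) (var 3)))))).

Definition diagonal : rexp := RLoad (entry (var 1) (var 1)).

(* Instead of searching for a pivot and exchanging rows, add lower rows to the
   current one as long as its diagonal entry vanishes. *)
Definition pivot : cmd :=
  For (NConst 2) (var 0)
    (If (And (Not (NLe (var 2) (var 1)))
             (And (RLe diagonal (RConst 0)) (RLe (RConst 0) diagonal)))
        (Seq (RStore free_cell (RConst 1)) (add_row 1 2))
        Skip).

Definition eliminate : cmd :=
  For (NConst 2) (var 0)
    (If (And (NLe (var 2) (var 1)) (NLe (var 1) (var 2)))
        Skip
        (Seq (RStore free_cell
               (RSub (RConst 0) (RDiv (RLoad (entry (var 2) (var 1))) diagonal)))
             (add_row 2 1))).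

Definition gauss_jordan : cmd :=
  Seq (For (NConst 1) (var 0) (Seq pivot eliminate))
      (For (NConst 2) (var 0)
         (RStore (var 2)
            (RDiv (RLoad (entry (var 2) (var 0)))
                  (RLoad (entry (var 2) (var 2)))))).

(** * Row operations on augmented matrices and the vectors they annihilate *)

Section MatrixMemory.
Variable R : realType.
Implicit Types (r : nat -> R) (M : nat -> nat -> R).

Definition stores_rows r N M : Prop :=
  forall i j, (i < N)%N -> (j <= N)%N -> r (i * (N + 1) + j)%N = M i j.

Lemma entry_lt N i j : (i < N)%N -> (j <= N)%N ->
  (i * (N + 1) + j < N * (N + 1))%N.
Proof. by move=> iN jN; nia. Qed.

Lemma entry_inj N i j i' j' : (j <= N)%N -> (j' <= N)%N ->
  (i * (N + 1) + j == i' * (N + 1) + j')%N = (i == i') && (j == j').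
Proof.
move=> jN j'N; apply/eqP/andP => [e|[/eqP -> /eqP ->] //].
have ii : i = i' by nia.
by split; apply/eqP => //; move: e; rewrite ii; lia.
Qed.

Lemma stores_rows_upd r N M i j x : (j <= N)%N -> stores_rows r N M ->
  stores_rows (upd r (i * (N + 1) + j)%N x) N
    (fun i' j' => if (i' == i) && (j' == j) then x else M i' j').
Proof.
move=> jN st i' j' i'N j'N; rewrite /upd entry_inj //.
by case: ifP => // _; exact: st.
Qed.

Lemma stores_rows_out r N M a x : (N * (N + 1) <= a)%N -> stores_rows r N M ->
  stores_rows (upd r a x) N M.
Proof.
move=> Na st i j iN jN; rewrite /upd; case: eqP => [e|_]; last exact: st.
by have := entry_lt iN jN; rewrite e ltnNge Na.
Qed.

Lemma stores_rows_ext r N M M' :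
  (forall i j, (i < N)%N -> (j <= N)%N -> M i j = M' i j) ->
  stores_rows r N M -> stores_rows r N M'.
Proof. by move=> e st i j iN jN; rewrite st // e. Qed.

(* Homogenization: for an augmented matrix [M = [A | b]], the solutions [x] of
   [A *m x = b] are the annihilated vectors [z] with [z N = -1]. *)
Definition annihilates N M (z : nat -> R) : Prop :=
  forall i, (i < N)%N -> \sum_(l < N.+1) M i l * z l = 0.

Definition row_op P Q f M : nat -> nat -> R :=
  fun i l => if i == P then M P l + f * M Q l else M i l.

(** Row [Q] is unchanged, so its equation can be subtracted again. *)
Lemma row_op_annihilates N P Q f M z : (P < N)%N -> (Q < N)%N -> P != Q ->
  annihilates N (row_op P Q f M) z <-> annihilates N M z.
Proof.
move=> PN QN PQ.
have sumP : \sum_(l < N.+1) row_op P Q f M P l * z l =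
    \sum_(l < N.+1) M P l * z l + f * \sum_(l < N.+1) M Q l * z l.
  rewrite mulr_sumr -big_split /=; apply: eq_bigr => l _.
  by rewrite /row_op eqxx mulrDl mulrA.
have sumN i : i != P ->
    \sum_(l < N.+1) row_op P Q f M i l * z l = \sum_(l < N.+1) M i l * z l.
  by move=> iP; apply: eq_bigr => l _; rewrite /row_op (negbTE iP).
split=> an i iN; case: (eqVneq i P) => [->|iP].
- have := an _ PN; rewrite sumP -(sumN Q) 1?eq_sym // (an _ QN).
  by rewrite mulr0 addr0.
- by rewrite -sumN // an.
- by rewrite sumP !an // mulr0 addr0.
- by rewrite sumN // an.
Qed.

Definition cleared N j M : Prop :=
  forall l, (l < j)%N -> M l l != 0 /\
    forall i, (i < N)%N -> i != l -> M i l = 0.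

(** Row [Q] lies below the cleared part and vanishes in all cleared columns, so adding it changes
    nothing there. *)
Lemma row_op_cleared N j P Q f M : (P < N)%N -> (Q < N)%N -> P != Q -> (j <= Q)%N ->
  cleared N j M -> cleared N j (row_op P Q f M).
Proof.
move=> PN QN PQ jQ cl l lj; have [d z] := cl l lj.
have Ql : M Q l = 0 by rewrite z //; lia.
rewrite /row_op Ql mulr0 addr0; split=> [|i iN il].
  by case: (l =P P) => [<-|].
by case: (i =P P) => [<-|_]; apply: z.
Qed.

(* If [M j j] and everything below it vanish, column [j] is a combination of
   the cleared columns. *)
Lemma cleared_singular N j M : (j < N)%N -> cleared N j M ->
  (forall i, (j <= i < N)%N -> M i j = 0) ->
  exists z, [/\ annihilates N M z, z N = 0 & z j = 1].
Proof.
move=> jN cl zj.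
(* For [l < j], row [l] reduces to [M l l * z l + M l j = 0], which dictates the witness. *)
exists (fun l => if (l < j)%N then - M l j / M l l else (l == j)%:R); split.
- move=> i iN; rewrite (bigD1 (inord j)) //= inordK ?leqW //.
  rewrite ltnn eqxx mulr1.
  case: (ltnP i j) => ij.
    have [d _] := cl i ij.
    rewrite (bigD1 (inord i)) /=; last by rewrite -val_eqE /= !inordK //; lia.
    rewrite inordK; last lia.
    rewrite ij big1 => [|l /andP[lj li]]; first by field.
    rewrite -val_eqE /= inordK in lj; last lia.
    rewrite -val_eqE /= inordK in li; last lia.
    rewrite (negbTE lj); case: ifP => lj'; last by rewrite mulr0.
    by have [_ ->] := cl l lj'; rewrite ?mul0r // eq_sym.
  rewrite zj ?ij // add0r big1 // => l lj.
  rewrite -val_eqE /= inordK in lj; last lia.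
  rewrite (negbTE lj); case: ifP => lj'; last by rewrite mulr0.
  have [_ ->] := cl l lj'; rewrite ?mul0r //; lia.
- have -> : (N < j)%N = false by lia.
  by have -> : (N == j) = false by lia.
- by rewrite ltnn eqxx.
Qed.

End MatrixMemory.

Section Commands.
Variables (R : realType) (n : nat) (H : 'M[R]_n) (c : config n).
Implicit Types s : machine R.

Lemma exec_Skip s : exec H c Skip s = s.
Proof. by []. Qed.

Lemma exec_Seq p q s : exec H c (Seq p q) s = exec H c q (exec H c p s).
Proof. by []. Qed.

Lemma exec_If b p q s : exec H c (If b p q) s =
  exec H c (if teval H c s b then p else q) (tick (Defs.tsize b).+1 s).
Proof. by rewrite /=; case: ifP. Qed.

Lemma rmem_RStore a e s : rmem (exec H c (RStore a e) s) =
  upd (rmem s) (neval c s a) (reval H c s e).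
Proof. by []. Qed.

Lemma nmem_RStore a e s : nmem (exec H c (RStore a e) s) = nmem s.
Proof. by []. Qed.

Lemma exec_NStore a e s : exec H c (NStore a e) s =
  tick (nsize a + nsize e).+1 (nwrite (neval c s a) (neval c s e) s).
Proof. by []. Qed.

End Commands.

(* Keeps [/=] from unfolding the execution of whole programs. *)
Opaque exec.

(** * Correctness of the elimination *)

Section Solver.
Variables (R : realType) (n : nat) (H : 'M[R]_n) (c : config n).
Implicit Types (s : machine R) (M : nat -> nat -> R).

Lemma add_row_spec s p q N M : (p != 3)%N -> (q != 3)%N -> nmem s 0%N = N ->
  (nmem s p < N)%N -> (nmem s q < N)%N -> nmem s p != nmem s q ->
  stores_rows (rmem s) N M ->
  stores_rows (rmem (exec H c (add_row p q) s)) N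
    (row_op (nmem s p) (nmem s q) (rmem s (N * (N + 1))%N) M).
Proof.
move=> p3 q3 s0; set P := nmem s p; set Q := nmem s q; set f := rmem s _.
move=> PN QN PQ st.
pose I l r := stores_rows r N (fun i l' =>
    if (i == P) && (l' < l)%N then M P l' + f * M Q l' else M i l') /\
  r (N * (N + 1))%N = f.
have : I (N + 1)%N (rmem (exec H c (add_row p q) s)).
  have -> : (N + 1)%N = neval c s width by rewrite /= s0.
  apply: for_rmem => [|l s' /= lN s'3 fr [st' sf]].
    by split=> //; apply: stores_rows_ext st => i l _ _; rewrite andbF.
  rewrite ?s0 in lN.
  have s'p : nmem s' p = P by rewrite fr ?p3.
  have s'q : nmem s' q = Q by rewrite fr ?q3.
  rewrite rmem_RStore /= s'3 s'p s'q fr // s0.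
  have lN' : (l <= N)%N by lia.
  split; last first.
    by rewrite /upd; case: eqP => // e; have := entry_lt PN lN'; rewrite -e ltnn.
  have := stores_rows_upd P (M P l + f * M Q l) lN' st'.
  rewrite sf !st' // ltnn !andbF; apply: stores_rows_ext => i l' iN l'N.
  case: (eqVneq i P) => [->|_] //=; rewrite ltnS.
  case: (eqVneq l' l) => [->|ne]; first by rewrite leqnn.
  by rewrite ltn_neqAle ne.
case=> + _; apply: stores_rows_ext => i l iN lN.
by rewrite /row_op; case: eqP => //= _; have -> : (l < N + 1)%N by lia.
Qed.

(** If the diagonal entry were still zero at the end, the column below it would vanish too, and
    [cleared_singular] would contradict the assumption on annihilated vectors. *)
Lemma pivot_spec s N M j : nmem s 0%N = N -> nmem s 1%N = j -> (j < N)%N ->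
  stores_rows (rmem s) N M -> cleared N j M ->
  (forall z, annihilates N M z -> z N = 0 -> z j = 0) ->
  exists M', [/\ stores_rows (rmem (exec H c pivot s)) N M',
    forall z, annihilates N M' z <-> annihilates N M z,
    cleared N j M' & M' j j != 0].
Proof.
move=> s0 s1 jN st cl ker.
(* The bound [maxn j.+1 k] keeps row [j] itself in range while the counter has not yet passed
   [j]. *)
pose I k r := exists M', [/\ stores_rows r N M',
    forall z, annihilates N M' z <-> annihilates N M z, cleared N j M' &
    M' j j != 0 \/ forall i, (j <= i < maxn j.+1 k)%N -> (i < N)%N -> M' i j = 0].
have : I N (rmem (exec H c pivot s)).
  have -> : N = neval c s (var 0) by rewrite /= s0.
  apply: for_rmem => [|k s' /= kN s'2 fr [M' [st' an' cl' d']]].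
    exists M; split=> //; case: (eqVneq (M j j) 0) => [z|]; [right|by left].
    by move=> i ij _; have -> : i = j by lia.
  rewrite ?s0 in kN; rewrite exec_If /= s'2 !fr //= s0 s1 st' //; last exact: ltnW.
  rewrite -eq_le.
  case: (leqP k j) => kj /=.
    exists M'; split=> //; case: d' => [|z]; [by left|right=> i ij; apply: z; lia].
  case: eqP => [z0|/eqP nz]; last by exists M'; split=> //; left.
  rewrite exec_Seq; set s1' := exec H c (RStore _ _) _.
  have s1'm : nmem s1' = nmem s' by [].
  have s1'r : rmem s1' = upd (rmem s') (N * (N + 1))%N 1.
    by rewrite rmem_RStore /= ?s'2 !fr // s0 ?s1 ?st' // ltnW.
  have := @add_row_spec s1' 1%N 2%N N M'.
  rewrite s1'm s'2 !fr // s0 s1 => /(_ isT isT erefl jN kN).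
  have jk : j != k by lia.
  have st1 : stores_rows (rmem s1') N M' by rewrite s1'r; apply: stores_rows_out.
  move=> /(_ jk st1).
  have -> : rmem s1' (N * (N + 1))%N = 1 by rewrite s1'r /upd eqxx.
  move=> st2; eexists; split; first exact: st2.
  - by move=> z; rewrite row_op_annihilates // an'.
  - by apply: row_op_cleared => //; apply: ltnW.
  rewrite /row_op eqxx z0 add0r mul1r.
  case: (eqVneq (M' k j) 0) => [z|nz]; [right|by left] => i ij iN.
  case: eqP => [_|/eqP ij']; first exact: z.
  case: (eqVneq i k) => [->//|ik].
  by case: d' => [|/(_ i)]; [rewrite z0 eqxx|apply=> //; lia].
move=> [M' [st' an' cl' d']]; exists M'; split=> //.
case: d' => // z; have [|w [wan wN wj]] := cleared_singular jN cl' (M := M').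
  by move=> i /andP[ji iN]; apply: z => //; lia.
by move/an': wan => /ker /(_ wN)/eqP; rewrite wj oner_eq0.
Qed.

Lemma eliminate_spec s N M j : nmem s 0%N = N -> nmem s 1%N = j -> (j < N)%N ->
  stores_rows (rmem s) N M -> cleared N j M -> M j j != 0 ->
  exists M', [/\ stores_rows (rmem (exec H c eliminate s)) N M',
    forall z, annihilates N M' z <-> annihilates N M z & cleared N j.+1 M'].
Proof.
move=> s0 s1 jN st cl d.
pose I k r := exists M', [/\ stores_rows r N M',
    forall z, annihilates N M' z <-> annihilates N M z, cleared N j M' &
    M' j j != 0 /\ forall i, (i < k)%N -> (i < N)%N -> i != j -> M' i j = 0].
have : I N (rmem (exec H c eliminate s)).
  have -> : N = neval c s (var 0) by rewrite /= s0.
  apply: for_rmem => [|k s' /= kN s'2 fr [M' [st' an' cl' [d' z']]]].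
    by exists M.
  rewrite ?s0 in kN; rewrite exec_If /= s'2 fr // s1 -eqn_leq; case: eqP => [kj|/eqP kj].
    exists M'; split=> //; split=> // i ik iN ij; apply: z' => //; lia.
  rewrite exec_Seq; set s1' := exec H c (RStore _ _) _.
  have s1'm : nmem s1' = nmem s' by [].
  have s1'r : rmem s1' = upd (rmem s') (N * (N + 1))%N (0 - M' k j / M' j j).
    by rewrite rmem_RStore /= ?s'2 !fr // s0 ?s1 ?st' // ltnW.
  have := @add_row_spec s1' 2%N 1%N N M'.
  rewrite s1'm s'2 !fr // s0 s1 => /(_ isT isT erefl kN jN kj).
  have st1 : stores_rows (rmem s1') N M' by rewrite s1'r; apply: stores_rows_out.
  move=> /(_ st1).
  have -> : rmem s1' (N * (N + 1))%N = 0 - M' k j / M' j j by rewrite s1'r /upd eqxx.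
  move=> st2; eexists; split; first exact: st2.
  - by move=> z; rewrite row_op_annihilates // an'.
  - exact: row_op_cleared.
  rewrite /row_op [j == k]eq_sym (negbTE kj); split=> // i ik iN ij.
  case: eqP => [_|/eqP ik']; first by field.
  by apply: z' => //; lia.
move=> [M' [st' an' cl' [d' z']]]; exists M'; split=> // l; rewrite ltnS leq_eqVlt.
by case: eqP => [-> _|_ /cl' //]; split=> // i iN; apply: z'.
Qed.

Lemma gauss_jordan_spec s N M : nmem s 0%N = N -> stores_rows (rmem s) N M ->
  (forall z, annihilates N M z -> z N = 0 -> forall l, (l < N)%N -> z l = 0) ->
  exists z, [/\ annihilates N M z, z N = -1 &
    forall i, (i < N)%N -> rmem (exec H c gauss_jordan s) i = z i].
Proof.
move=> s0 st ker; rewrite /gauss_jordan exec_Seq.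
set loop1 := For (NConst 1) _ _; set loop2 := For (NConst 2) _ _.
pose I j r := exists M', [/\ stores_rows r N M',
    forall z, annihilates N M' z <-> annihilates N M z & cleared N j M'].
have [M' [st' an' cl']] : I N (rmem (exec H c loop1 s)).
  have -> : N = neval c s (var 0) by rewrite /= s0.
  apply: for_rmem => [|j s' /= jN s'1 fr [M' [st' an' cl']]]; first by exists M.
  rewrite ?s0 in jN.
  have s'0 : nmem s' 0%N = N by rewrite fr.
  have [|M1 [st1 an1 cl1 d1]] := pivot_spec s'0 s'1 jN st' cl'.
    by move=> z /an' an zN; apply: (ker z).
  have p0 : nmem (exec H c pivot s') 0%N = N by rewrite keeps_exec.
  have p1 : nmem (exec H c pivot s') 1%N = j by rewrite keeps_exec.
  have [M2 [st2 an2 cl2]] := eliminate_spec p0 p1 jN st1 cl1 d1.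
  by exists M2; split=> // z; rewrite an2 an1 an'.
pose s1 := exec H c loop1 s.
have s10 : nmem s1 0%N = N by rewrite keeps_exec.
pose z l := if (l < N)%N then M' l N / M' l l else -1.
exists z; split.
- apply/an' => i iN; rewrite big_ord_recr /= {2}/z ltnn mulrN1.
  have [d _] := cl' i iN.
  rewrite (bigD1 (Ordinal iN)) //= /z iN big1 ?addr0 => [|l li].
    by field.
  have [_ ->] := cl' l (ltn_ord l); rewrite ?mul0r // eq_sym.
  by rewrite -val_eqE /= in li.
- by rewrite /z ltnn.
(* The results overwrite the matrix. Row [k] starts at cell [k * (N + 1)], hence not before cell
   [k], and is still intact when its turn comes. *)
pose J k r := (forall i, (i < k)%N -> (i < N)%N -> r i = z i) /\
  forall a, (k <= a)%N -> (a != 0)%N || (k == 0)%N -> r a = rmem s1 a.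
have : J N (rmem (exec H c loop2 s1)).
  have -> : N = neval c s1 (var 0) by rewrite /= s10.
  apply: for_rmem => [|k s' /= kN s'2 fr [done rest]]; first by split.
  rewrite ?s10 in kN; rewrite rmem_RStore /= s'2 !fr //= s10.
  have get j : (k <= j <= N)%N -> rmem s' (k * (N + 1) + j)%N = M' k j.
    by move=> kj; rewrite rest; [apply: st' => //; lia|nia|nia].
  rewrite !get ?leqnn ?(ltnW kN) //.
  split=> [i ik iN|a ka a0]; rewrite /upd.
    case: eqP => [->|ik']; first by rewrite /z kN.
    by apply: done => //; lia.
  case: eqP => [e|_]; first by lia.
  by apply: rest; lia.
by case=> done _ i iN; apply: done.
Qed.

End Solver.

Lemma gauss_jordan_solver : linear_solver gauss_jordan.
Proof.
move=> R n H c s N A b unitA [s0 sA sb].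
pose M i j := if (j < N)%N then
    (if insub i is Some i' then if insub j is Some j' then A i' j' else 0 else 0)
  else if insub i is Some i' then b i' 0 else 0.
have MA (i j : 'I_N) : M i j = A i j by rewrite /M ltn_ord !valK.
have Mb (i : 'I_N) : M i N = b i 0 by rewrite /M ltnn valK.
have st : stores_rows (rmem s) N M.
  move=> i j iN; rewrite leq_eqVlt addn1 => /orP[/eqP ->|jN].
    by rewrite (sb (Ordinal iN)) (Mb (Ordinal iN)).
  by rewrite (sA (Ordinal iN) (Ordinal jN)) (MA (Ordinal iN) (Ordinal jN)).
(* With [z N = -1] this is the given system; with [z N = 0] invertibility of [A] forces the other
   coordinates to vanish. *)
have anE z : annihilates N M z <->
    A *m \col_i z i + z N *: b = 0.
  have row (i : 'I_N) : (A *m \col_i z i + z N *: b) i 0 =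
      \sum_(l < N.+1) M i l * z l.
    rewrite big_ord_recr /= !mxE Mb mulrC; congr (_ + _); apply: eq_bigr => l _.
    by rewrite mxE MA.
  split=> [an|e i iN]; last by have := row (Ordinal iN); rewrite e mxE => <-.
  by apply/matrixP => i j; rewrite ord1 row mxE an.
have [|z [/anE zan zN zE]] := @gauss_jordan_spec R n H c s N M s0 st.
  move=> z /anE + zN l lN; rewrite zN scale0r addr0 => /(congr1 (mulmx (invmx A))).
  by rewrite mulKmx // mulmx0 => /matrixP/(_ (Ordinal lN) 0); rewrite !mxE.
exists (\col_i z i); split; last by move=> i; rewrite zE // mxE.
by move: zan; rewrite zN scaleN1r => /subr0_eq.
Qed.

(** * Subsets of the agnostic nodes as bit masks *)

Section Encoding.
Variables (n : nat) (c : config n).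
Hypothesis n_gt0 : (0 < n)%N.

(** For an agnostic node [t] this is the position of its bit in a mask. *)
Definition rank (t : nat) : nat := (\sum_(0 <= i < t) (input_state c i == 0))%N.

Definition masks : nat := (2 ^ #|agnostic c|)%N.

(* A gnostic node gets the weight [masks], so that it belongs to no subset. *)
Definition mask_weight (i : nat) : nat :=
  if input_state c i == 0%N then (2 ^ rank i)%N else masks.

Definition mask_set (s : nat) : {set 'I_n} :=
  [set v : 'I_n | odd (s %/ mask_weight v)].

(** Unknowns are indexed by [s * n + v]; the remainder modulo [n] recovers the node and the quotient
    the mask. *)
Definition node (i : nat) : 'I_n := Ordinal (ltn_pmod i n_gt0).

Lemma input_state_ord (v : 'I_n) : (input_state c v == 0%N) = (v \in agnostic c).
Proof. by rewrite /input_state valK inE; case: (c v) => // -[]. Qed.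

Lemma input_state_red (v : 'I_n) : (input_state c v == 1%N) = (c v == Some true).
Proof. by rewrite /input_state valK; case: (c v) => // -[]. Qed.

Lemma rankS t : rank t.+1 = (rank t + (input_state c t == 0%N))%N.
Proof. by rewrite /rank big_nat_recr. Qed.

Lemma rank_n : rank n = #|agnostic c|.
Proof.
rewrite /rank big_mkord -sum1_card [RHS]big_mkcond /=; apply: eq_bigr => v _.
by rewrite input_state_ord; case: (v \in _).
Qed.

Lemma rank_le i j : (i <= j)%N -> (rank i <= rank j)%N.
Proof.
move=> /subnKC <-; elim: (j - i)%N => [|k IH]; rewrite ?addn0 // addnS rankS.
exact: leq_trans IH (leq_addr _ _).
Qed.

Lemma masks_gt0 : (0 < masks)%N. Proof. by rewrite expn_gt0. Qed.

Lemma pow_rank_le i : (i <= n)%N -> (2 ^ rank i <= masks)%N.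
Proof. by move=> ni; rewrite leq_exp2l // -rank_n rank_le. Qed.

Lemma mask_set_sub s : (s < masks)%N -> mask_set s \subset agnostic c.
Proof.
move=> sk; apply/subsetP => v; rewrite inE /mask_weight input_state_ord.
by case: ifP => // _; rewrite divn_small.
Qed.

Lemma mask_set0 : mask_set 0 = set0.
Proof. by apply/setP => v; rewrite !inE div0n. Qed.

Lemma mask_set_full : mask_set masks.-1 = agnostic c.
Proof.
apply/eqP; rewrite eqEsubset mask_set_sub ?prednK ?masks_gt0 //=.
apply/subsetP => v vA; rewrite inE /mask_weight input_state_ord vA.
have lt : (rank v < #|agnostic c|)%N.
  have := rank_le (ltn_ord v); rewrite rankS input_state_ord vA addn1.
  by rewrite rank_n.
(* All binary digits of [masks.-1] are 1, so its quotient by [2 ^ rank v] is an even positive number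
   minus 1. *)
have -> : masks.-1 = ((2 ^ (#|agnostic c| - rank v).-1).*2.-1 * 2 ^ rank v
                     + (2 ^ rank v).-1)%N.
  rewrite -mul2n -expnS prednK ?subn_gt0 // /masks.
  rewrite -{1}(subnK (ltnW lt)) expnD.
  have : (0 < 2 ^ rank v)%N by rewrite expn_gt0.
  have : (0 < 2 ^ (#|agnostic c| - rank v))%N by rewrite expn_gt0.
  by move: (2 ^ _)%N (2 ^ _)%N => a b; nia.
rewrite divnMDl ?expn_gt0 // [X in (_ + X)%N]divn_small ?addn0; last first.
  by rewrite prednK ?expn_gt0.
have : (0 < 2 ^ (#|agnostic c| - rank v).-1)%N by rewrite expn_gt0.
by case: (2 ^ _)%N => // p _; rewrite doubleS /= odd_double.
Qed.

(** Scanning the nodes, each agnostic one reveals one more binary digit; after all [n] nodes the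
    whole mask is known. *)
Lemma mask_set_inj s s' : (s < masks)%N -> (s' < masks)%N ->
  mask_set s = mask_set s' -> s = s'.
Proof.
move=> sk s'k e.
suff low t : (t <= n)%N -> (s %% 2 ^ rank t = s' %% 2 ^ rank t)%N.
  by have := low n (leqnn n); rewrite rank_n !modn_small.
elim: t => [|t IH] tn; first by rewrite /rank big_geq // expn0 !modn1.
rewrite rankS; have := IH (ltnW tn); case: eqP => [/eqP t0|_]; last by rewrite addn0.
have /setP/(_ (Ordinal tn)) := e; rewrite !inE /mask_weight /= t0 addn1 expnS.
set p := (2 ^ rank t)%N => o m.
have split x : (x %% (2 * p) = odd (x %/ p) * p + x %% p)%N.
  have p0 : (0 < p)%N by rewrite expn_gt0.
  rewrite {1}(divn_eq x p) -{1}(odd_double_half (x %/ p)) mulnDl -addnA addnCA.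
  rewrite -muln2 -mulnA modnMDl modn_small // mul2n -addnn.
  have := ltn_pmod x p0; case: (odd _) => /=; lia.
by rewrite !split o m.
Qed.

(** Injectivity together with equal cardinalities gives surjectivity. *)
Lemma mask_set_image : [set mask_set s | s : 'I_masks] = powerset (agnostic c).
Proof.
apply/eqP; rewrite eqEcard card_powerset card_imset ?card_ord ?leqnn ?andbT.
  by apply/subsetP => _ /imsetP[s _ ->]; rewrite powersetE mask_set_sub.
by move=> s s' /mask_set_inj e; apply/val_inj/e.
Qed.

Lemma mask_set_onto (S : {set 'I_n}) : S \subset agnostic c ->
  exists2 s, (s < masks)%N & mask_set s = S.
Proof. by rewrite -powersetE -mask_set_image => /imsetP[s _ ->]; exists s. Qed.

Lemma sum_masks (R : realType) (G : {set 'I_n} -> R) :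
  \sum_(s < masks) G (mask_set s) = \sum_(S : {set 'I_n} | S \subset agnostic c) G S.
Proof.
under [RHS]eq_bigl => S do rewrite -powersetE -mask_set_image.
by rewrite big_imset //= => s s' _ _ /mask_set_inj e; apply/val_inj/e.
Qed.

Lemma sum_states (R : realType) (G : {set 'I_n} -> 'I_n -> R) :
  \sum_(j < masks * n) G (mask_set (j %/ n)) (node j) =
  \sum_(S : {set 'I_n} | S \subset agnostic c) \sum_u G S u.
Proof.
rewrite -(sum_masks (fun S => \sum_u G S u)).
rewrite -(big_mkord xpredT (fun j => G (mask_set (j %/ n)) (node j))) big_nat_mul.
rewrite big_mkord; apply: eq_bigr => s _.
rewrite -{1}[(s * n)%N]add0n big_addn mulSn addnK big_mkord.
apply: eq_bigr => u _; rewrite addnC divnMDl // divn_small // addn0.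
by congr (G _ _); apply: val_inj; rewrite /= modnMDl modn_small.
Qed.

End Encoding.

(** * The program writing the linear system *)

(* Natural cells: 0 number of unknowns, 1 number of masks, 2, 4 and 5 loop
   counters, [10 + v] the mask weight of node [v]. *)
Definition weight_of (e : nexp) : nexp := NLoad (NAdd (NConst 10) e).

Definition is_agnostic (e : nexp) : test := NLe (NState e) (NConst 0).

(** Cell 1 doubles at each agnostic node. Gnostic nodes need a second pass because their weight is
    the final value, [masks c]. *)
Definition write_weights : cmd :=
  Seq (NStore (NConst 1) (NConst 1))
  (Seq (For (NConst 2) NNodes
         (If (is_agnostic (var 2))
             (Seq (NStore (NAdd (NConst 10) (var 2)) (var 1))
                  (NStore (NConst 1) (NMul (var 1) (NConst 2))))
             Skip))
  (Seq (For (NConst 2) NNodes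
         (If (is_agnostic (var 2)) Skip
             (NStore (NAdd (NConst 10) (var 2)) (var 1))))
       (NStore (NConst 0) (NAdd (NConst 1) (NMul NNodes (var 1)))))).

Definition equal (a b : nexp) : test := And (NLe a b) (NLe b a).

Definition member (s v : nexp) : test :=
  NLe (NConst 1) (NMod (NDiv s (weight_of v)) (NConst 2)).

Definition unknowns : nexp := NSub (var 0) (NConst 1).
Definition mask_of (i : nexp) : nexp := NDiv i NNodes.
Definition node_of (i : nexp) : nexp := NMod i NNodes.

(* Real scratch cells after the matrix: 0 product of the active factors, 1 and 2
   the sum and product of [coefficient], 3 and 4 the current factors, 5 the
   number of nodes; the table of agnostic masses starts at 6. *)
Definition scratch (a : nat) : nexp := NAdd free_cell (NConst a).
Definition put (a : nat) (x : rexp) : cmd := RStore (scratch a) x.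
Definition get (a : nat) : rexp := RLoad (scratch a).
Definition mass_cell (i : nexp) : nexp := NAdd (scratch 6) i.

Definition write_masses : cmd :=
  For (NConst 2) unknowns
    (Seq (RStore (mass_cell (var 2)) (RConst 0))
         (For (NConst 5) NNodes
            (If (member (mask_of (var 2)) (var 5))
                (RStore (mass_cell (var 2))
                   (RAdd (RLoad (mass_cell (var 2)))
                         (RMatrix (node_of (var 2)) (var 5))))
                Skip))).

(** Unknown 0 is the answer, from which the unknowns of the red nodes in the full agnostic layer are
    subtracted; that layer has the last mask, [masks c - 1]. *)
Definition write_answer_row : cmd :=
  Seq (RStore (NConst 0) (RConst 1))
      (For (NConst 5) NNodes
         (If (equal (NState (var 5)) (NConst 1))
             (RStore (NAdd (NConst 1)
                        (NAdd (NMul (NSub (var 1) (NConst 1)) NNodes) (var 5)))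
                     (RSub (RConst 0) (RConst 1)))
             Skip)).

Definition put_factors (x y : rexp) : cmd := Seq (put 3 x) (put 4 y).

(** The branches follow [activeE] and [stillE]. *)
Definition factors : cmd :=
  let S := mask_of (var 2) in let v := node_of (var 2) in
  let S' := mask_of (var 4) in let u := node_of (var 4) in let w := var 5 in
  let mass := RLoad (mass_cell (NAdd (NMul S NNodes) w)) in
  If (equal w u)
    (If (member S' w) (put_factors (RConst 0) (RConst 0))
      (If (member S w)
        (If (member S v) (put_factors (RConst 0) (RConst 0))
                         (put_factors (RMatrix w v) (RConst 0)))
        (If (equal w v) (put_factors (RAdd (RMatrix w v) mass) (RConst 1))
          (If (member S v) (put_factors (RConst 0) (RConst 0))
                           (put_factors (RMatrix w v) (RConst 0))))))
    (If (member S w)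
      (If (member S' w) (put_factors mass (RConst 1))
                        (put_factors (RSub (RConst 1) mass) (RConst 0)))
      (If (member S' w) (put_factors (RConst 0) (RConst 0))
                        (put_factors (RConst 1) (RConst 1)))).

(** A single pass serves both modes: the sum over [w] of [active w] times the other [still] factors
    is updated by [sum_prod_recr], without division. Cell 5 counts the nodes to obtain [n] as a real
    number. *)
Definition coefficient : cmd :=
  Seq (put 0 (RConst 1)) (Seq (put 1 (RConst 0)) (Seq (put 2 (RConst 1))
  (Seq (put 5 (RConst 0))
  (For (NConst 5) NNodes
    (Seq factors
    (Seq (put 1 (RAdd (RMul (get 1) (get 4)) (RMul (get 3) (get 2))))
    (Seq (put 2 (RMul (get 2) (get 4)))
    (Seq (put 0 (RMul (get 0) (get 3)))
         (put 5 (RAdd (get 5) (RConst 1))))))))))).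

Definition coefficient_value (m : mode) : rexp :=
  if m is Synchronous then get 0 else RDiv (get 1) (get 5).

(** Rows and columns are shifted by one because of the answer. Balance 0 belongs to the empty set
    and node 0 and is replaced by the normalization. *)
Definition write_balances (m : mode) : cmd :=
  let target := entry (NAdd (var 2) (NConst 1)) (NAdd (var 4) (NConst 1)) in
  For (NConst 2) unknowns
    (For (NConst 4) unknowns
      (If (NLe (var 2) (NConst 0))
        (If (NLe (mask_of (var 4)) (NConst 0))
            (RStore target (RConst 1)) (RStore target (RConst 0)))
        (Seq coefficient
          (If (equal (var 2) (var 4))
            (RStore target (RSub (RConst 1) (coefficient_value m)))
            (RStore target (RSub (RConst 0) (coefficient_value m))))))).

(** The right-hand side is zero, as in the initial memory, except in the normalization row 1. *)
Definition write_system (m : mode) : cmd :=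
  Seq write_masses (Seq write_answer_row (Seq (write_balances m)
      (RStore (entry (NConst 1) (var 0)) (RConst 1)))).

Definition build_system (m : mode) : cmd := Seq write_weights (write_system m).

(** * Mask weights and the memory layout *)

Section Weights.
Variables (R : realType) (n : nat) (H : 'M[R]_n) (c : config n).
Hypothesis n_gt0 : (0 < n)%N.
Implicit Types s : machine R.

Definition system_size : nat := (masks c * n).+1.

Definition layout s : Prop :=
  [/\ nmem s 0%N = system_size, nmem s 1%N = masks c
    & forall v, (v < n)%N -> nmem s (10 + v)%N = mask_weight c v].

(** Generous room for the augmented matrix, the scratch cells, the table of masses and the mask
    weights. *)
Definition footprint_bound : nat := (10 * system_size.+1 ^ 2)%N.

(** [write_weights] stores naturals and therefore falls outside [bounded]; its time is estimated
    through this criterion instead. *)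
Fixpoint node_loops (p : cmd) : bool :=
  match p with
  | Seq p1 p2 | If _ p1 p2 => node_loops p1 && node_loops p2
  | For _ NNodes q => node_loops q
  | For _ _ _ => false
  | _ => true
  end.

Lemma node_loops_elapsed p s : node_loops p ->
  (elapsed (exec H c p s) <= elapsed s + weight p * n.+1 ^ depth p)%N.
Proof.
have grow a k l : (k <= l)%N -> (a * n.+1 ^ k <= a * n.+1 ^ l)%N.
  by move=> kl; rewrite leq_mul2l leq_pexp2l ?orbT.
elim: p s => [s _|a e s _|a e s _|p1 IH1 p2 IH2 s /andP[l1 l2]
             |b p1 IH1 p2 IH2 s /andP[l1 l2]|a e q IH s lq].
- by rewrite leq_addr.
- by rewrite expn0 muln1.
- by rewrite expn0 muln1.
- rewrite exec_Seq (leq_trans (IH2 _ l2)) //= mulnDl addnA leq_add ?grow ?leq_maxr //.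
  by rewrite (leq_trans (IH1 _ l1)) // leq_add2l grow // leq_maxl.
- rewrite exec_If; set s' := tick _ s.
  have le : (elapsed s' + (weight p1 + weight p2) * n.+1 ^ depth (If b p1 p2) <=
      elapsed s + weight (If b p1 p2) * n.+1 ^ depth (If b p1 p2))%N.
    by rewrite /= -addnA leq_add2l [leqRHS]mulnDl leq_add2r leq_pmulr // expn_gt0.
  apply: (leq_trans _ le); case: ifP => _.
    rewrite (leq_trans (IH1 _ l1)) // leq_add2l mulnDl.
    by rewrite (leq_trans _ (leq_addr _ _)) // grow // leq_maxl.
  rewrite (leq_trans (IH2 _ l2)) // leq_add2l mulnDl.
  by rewrite (leq_trans _ (leq_addl _ _)) // grow // leq_maxr.
- case: e lq => //= lq.
  set t := (nsize a + 1).+1.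
  pose I i s' := (elapsed s' <= elapsed s + t + i * (1 + weight q * n.+1 ^ depth q))%N.
  have : I (neval c s NNodes) (exec H c (For a NNodes q) s).
    apply: (for_ind (I := I)) => [|i s' ik el]; first by rewrite /I addn0.
    rewrite /I (leq_trans (IH _ lq)) //= mulSn.
    by move: el; rewrite /I; lia.
  rewrite /I /= => el; rewrite (leq_trans el) // -addnA leq_add2l.
  rewrite mulnDl leq_add // ?leq_pmulr ?expn_gt0 //.
  rewrite expnS mulnCA (leq_trans (leq_mul (leqnSn n) (leqnn _))) //.
  by rewrite leq_mul2l /= mulnDl mul1n leq_add2r expn_gt0.
Qed.

Lemma write_weights_spec : let s := exec H c write_weights (machine0 R) in
  [/\ layout s, rmem s = (fun=> 0), forall a, (nmem s a <= system_size)%N,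
      (footprint s <= footprint_bound)%N &
      (elapsed s <= weight write_weights * n.+1)%N].
Proof.
have nD : (n < system_size)%N by rewrite ltnS leq_pmull // masks_gt0.
have KD : (masks c < system_size)%N by rewrite ltnS leq_pmulr.
have FD a : (a <= system_size + 10)%N -> (a <= footprint_bound)%N.
  by rewrite /footprint_bound; move: system_size => d; nia.
pose ok s := [/\ rmem s = (fun=> 0), forall a, (nmem s a <= system_size)%N &
  (footprint s <= footprint_bound)%N].
have okw s a z : ok s -> (a < system_size + 10)%N -> (z <= system_size)%N -> ok (nwrite a z s).
  move=> [r0 nm fp] aD zD; split=> //= [b|]; first by rewrite /upd; case: ifP.
  by rewrite !geq_max fp !FD //; lia.
have okt s z : ok s -> ok (tick z s) by case.
have time : (elapsed (exec H c write_weights (machine0 R)) <=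
    weight write_weights * n.+1)%N.
  by rewrite (leq_trans (node_loops_elapsed _ _)) // add0n leq_mul2l expn1 leqnn orbT.
move: time; rewrite /write_weights !exec_Seq.
set s1 := exec H c (NStore (NConst 1) _) _.
have ok1 : ok s1.
  by apply/okt/okw => /=; [split|lia|].
have cell1 : nmem s1 1%N = 1%N by [].
pose I1 t s := [/\ ok s, nmem s 1%N = (2 ^ rank c t)%N &
  forall v, (v < t)%N -> input_state c v = 0%N ->
    nmem s (10 + v)%N = mask_weight c v].
set s2 := exec H c _ s1.
have [ok2 s21 s2w] : I1 n s2.
  apply: (for_ind (I := I1)) => [|i s' /= ni [ok' s'1 s'w]].
    by split=> //; rewrite /rank big_geq.
  have ok'' : ok (tick 1 (nwrite 2 i s')).
    by apply/okt/okw; [done|lia|exact: ltnW (ltn_trans ni nD)].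
  rewrite exec_If /= /upd /= leqn0; case: eqP => [i0|i0].
    rewrite exec_Seq !exec_NStore; split.
    - apply/okt/okw => /=; [apply/okt/okw => /=|lia|].
      + exact: okt.
      + by rewrite /upd /=; lia.
      + by have [_ + _] := ok'; apply.
      rewrite /upd /= s'1 -expnSr.
      have := pow_rank_le c ni; rewrite rankS i0 addn1 => /leq_trans; apply.
      exact: ltnW.
    - by rewrite /= /upd /= s'1 rankS i0 addn1 expnSr.
    - move=> v; rewrite ltnS leq_eqVlt /= /upd /= => /orP[/eqP -> _|vi v0].
        by rewrite eqxx s'1 /mask_weight i0.
      by rewrite eqn_add2l ltn_eqF // s'w.
  rewrite exec_Skip.
  split; [exact: ok''|by rewrite /= /upd /= rankS (introF eqP i0) addn0|].
  move=> v; rewrite ltnS leq_eqVlt => /orP[/eqP -> //|vi v0].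
  by rewrite /= /upd /= s'w.
pose I2 t s := [/\ ok s, nmem s 1%N = masks c &
  forall v, (v < n)%N -> (input_state c v == 0%N) || (v < t)%N ->
    nmem s (10 + v)%N = mask_weight c v].
set s3 := exec H c _ s2.
have [ok3 s31 s3w] : I2 n s3.
  apply: (for_ind (I := I2)) => [|i s' /= ni [ok' s'1 s'w]].
    split=> //=; first by rewrite s21 rank_n.
    by move=> v vn; rewrite orbF => /eqP; apply: s2w.
  have ok'' : ok (tick 1 (nwrite 2 i s')).
    by apply/okt/okw; [done|lia|exact: ltnW (ltn_trans ni nD)].
  rewrite exec_If /= /upd /= leqn0; case: eqP => [i0|i0].
    rewrite exec_Skip; split=> // v vn; rewrite ltnS leq_eqVlt orbCA /= /upd /=.
    by case/orP => [/eqP ->|]; apply: s'w => //; rewrite i0.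
  rewrite exec_NStore; split.
  - apply/okt/okw => /=; [exact: okt|by rewrite /upd /=; lia|].
    by rewrite /upd /= s'1 ltnW.
  - by rewrite /= /upd /= s'1.
  - move=> v vn; rewrite ltnS leq_eqVlt orbCA /= /upd /= eqn_add2l.
    case: eqP => [-> _|_ /= h]; last exact: s'w.
    by rewrite s'1 /mask_weight (introF eqP i0).
set s4 := exec H c _ s3 => time.
have s4E : s4 = tick (1 + (1 + (1 + 2).+1).+1).+1 (nwrite 0 system_size s3).
  by rewrite /s4 exec_NStore /= s31 /system_size mulnC.
have [r4 n4 f4] : ok s4 by rewrite s4E; apply/okt/okw; [|lia|].
split=> //; split; first by rewrite s4E.
- by rewrite s4E.
- by move=> v vn; rewrite s4E /= /upd /= s3w // vn orbT.
Qed.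
End Weights.

(** * The entries of the linear system as computed by the program *)

Section System.
Variables (R : realType) (n : nat) (E : rel 'I_n) (H : 'M[R]_n) (c : config n).
Hypotheses (n_gt0 : (0 < n)%N) (HP : transition_matrix E H).
Implicit Types s : machine R.

Let K := masks c.
Let D := system_size c.
Let free := (D * (D + 1))%N.
Let nodeM := node n_gt0.
Let maskM i := mask_set c (i %/ n).

Lemma layout_frame s s' : (forall a, (a < 2)%N || (10 <= a)%N -> nmem s' a = nmem s a) ->
  layout c s -> layout c s'.
Proof. by move=> fr [l0 l1 lw]; split=> [||v vn]; rewrite fr ?lw // leq_addr orbT. Qed.

Lemma memberE s es ev (w : 'I_n) : layout c s -> neval c s ev = w ->
  teval H c s (member es ev) = (w \in mask_set c (neval c s es)).
Proof.
by move=> [_ _ lw] e; rewrite /= e lw // inE modn2; case: (odd _).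
Qed.

Lemma equalE s a b : teval H c s (equal a b) = (neval c s a == neval c s b).
Proof. by rewrite /= -eqn_leq. Qed.

Lemma input_matrix_ord (v u : 'I_n) : input_matrix H v u = H v u.
Proof. by rewrite /input_matrix !valK. Qed.

(** Lets families over nodes enter loop invariants, whose sums and products run over naturals. *)
Definition extend (x : R) (f : 'I_n -> R) (i : nat) : R :=
  if insub i is Some v then f v else x.

Lemma extend_ord x f (v : 'I_n) : extend x f v = f v.
Proof. by rewrite /extend valK. Qed.

Lemma scratchE s a : layout c s -> neval c s (scratch a) = (free + a)%N.
Proof. by case=> l0 _ _; rewrite /= l0. Qed.

Definition mass_value (i : nat) : R := agnostic_mass H (maskM i) (nodeM i).

Definition mass_table (r : nat -> R) : Prop :=
  forall i, (i < K * n)%N -> r (free + 6 + i)%N = mass_value i.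

Lemma write_masses_spec s : layout c s ->
  let r := rmem (exec H c write_masses s) in
  (forall a, (a < free + 6)%N -> r a = rmem s a) /\ mass_table r.
Proof.
move=> lay r.
pose I i r := (forall a, (a < free + 6)%N -> r a = rmem s a) /\
  forall i', (i' < i)%N -> r (free + 6 + i')%N = mass_value i'.
suff : I (K * n)%N r by [].
have -> : (K * n)%N = neval c s unknowns by case: lay => /= -> _ _; rewrite subn1.
apply: (for_rmem (I := I)) => [//|i s' iN s'2 fr [low done]].
have lay' : layout c s' by apply: layout_frame lay => a ha; apply: fr => /=; lia.
rewrite exec_Seq; set s1 := exec H c _ s'.
have lay1 : layout c s1 by [].
have cellE s2 : layout c s2 -> nmem s2 2%N = i ->
    neval c s2 (mass_cell (var 2)) = (free + 6 + i)%N.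
  by case=> l0 _ _ s22; rewrite /= l0 s22.
have r1 : rmem s1 = upd (rmem s') (free + 6 + i)%N 0 by rewrite rmem_RStore cellE.
have s12 : nmem s1 2%N = i by [].
pose g := extend 0 (fun y => if y \in maskM i then H (nodeM i) y else 0).
pose J y r := (forall a, a != (free + 6 + i)%N -> r a = rmem s' a) /\
  r (free + 6 + i)%N = \sum_(0 <= y' < y) g y'.
set r' := rmem _.
have [out new] : J n r'.
  apply: (for_rmem (I := J)) => [|y s2 yn s25 fr2 [out new]].
    rewrite /J r1 /upd eqxx big_geq //; split=> // a /negbTE -> //.
  have lay2 : layout c s2 by apply: layout_frame lay1 => a ha; apply: fr2 => /=; lia.
  have s22 : nmem s2 2%N = i by rewrite fr2.
  rewrite exec_If (@memberE _ _ _ (Ordinal yn)) //.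
  have -> : neval c s2 (mask_of (var 2)) = (i %/ n)%N by rewrite /= s22.
  rewrite /J big_nat_recr //= -new -/(maskM i).
  have gy : g y = if Ordinal yn \in maskM i then H (nodeM i) (Ordinal yn) else 0.
    exact: (extend_ord _ _ (Ordinal yn)).
  rewrite gy; case: ifP => _; last by rewrite exec_Skip addr0; split=> // a ha; rewrite /= out.
  have lay3 : layout c (tick (Defs.tsize (member (mask_of (var 2)) (var 5))).+1 s2) by [].
  rewrite rmem_RStore cellE //=.
  have -> : nmem s2 0%N = D by case: lay2.
  rewrite s22 s25 -/free /upd eqxx; split=> [a ha|]; first by rewrite (negbTE ha) out.
  by congr (_ + _); exact: (input_matrix_ord (nodeM i) (Ordinal yn)).
split=> [a ha|i']; first by rewrite out ?low //; lia.
rewrite ltnS leq_eqVlt => /orP[/eqP ->|i'i]; last first.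
  by rewrite out ?done // eqn_add2l ltn_eqF.
rewrite new big_mkord /mass_value /agnostic_mass [RHS]big_mkcond.
by apply: eq_bigr => y _; rewrite /g extend_ord.
Qed.

Lemma put_factorsE s x z : layout c s ->
  rmem (exec H c (put_factors x (RConst z)) s) =
  upd (upd (rmem s) (free + 3)%N (reval H c s x)) (free + 4)%N z%:R.
Proof.
by move=> lay; rewrite exec_Seq !rmem_RStore !scratchE.
Qed.

(** The new index either joins the products of the [Z] factors or is itself the distinguished
    one. *)
Lemma sum_prod_recr (A Z : nat -> R) t :
  \sum_(k < t.+1) A k * \prod_(l < t.+1 | (l : nat) != k) Z l =
  (\sum_(k < t) A k * \prod_(l < t | (l : nat) != k) Z l) * Z t +
  A t * \prod_(l < t) Z l.
Proof.
rewrite big_ord_recr /= mulr_suml; congr (_ + _).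
  apply: eq_bigr => k _; rewrite big_mkcond big_ord_recr -big_mkcond /=.
  by rewrite gtn_eqF // mulrA.
congr (_ * _); rewrite big_mkcond big_ord_recr /= eqxx mulr1.
by apply: eq_bigr => l _; rewrite ltn_eqF.
Qed.

Section Entry.
Variables i j : nat.
Hypotheses (iN : (i < K * n)%N) (jN : (j < K * n)%N).

Let S := maskM i.
Let S' := maskM j.
Let v := nodeM i.
Let u := nodeM j.

Lemma factors_spec s (w : 'I_n) : layout c s ->
  nmem s 2%N = i -> nmem s 4%N = j -> nmem s 5%N = w -> mass_table (rmem s) ->
  rmem (exec H c factors s) =
  upd (upd (rmem s) (free + 3)%N (active H S S' u v w))
      (free + 4)%N (still S S' u v w)%:R.
Proof.
move=> lay s2 s4 s5 tab.
have l0 : nmem s 0%N = D by case: lay.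
have laytick z : layout c (tick z s) by [].
have mS z x (w' : 'I_n) : neval c (tick z s) x = w' ->
    teval H c (tick z s) (member (mask_of (var 2)) x) = (w' \in S).
  by move=> e; rewrite (@memberE _ _ _ w') //= s2.
have mS' z x (w' : 'I_n) : neval c (tick z s) x = w' ->
    teval H c (tick z s) (member (mask_of (var 4)) x) = (w' \in S').
  by move=> e; rewrite (@memberE _ _ _ w') //= s4.
have ev z : neval c (tick z s) (node_of (var 2)) = v by rewrite /= s2.
have ew z : neval c (tick z s) (var 5) = w by rewrite /= s5.
have HE z : reval H c (tick z s) (RMatrix (var 5) (node_of (var 2))) = H w v.
  by rewrite /= s2 s5; exact: (input_matrix_ord w v).
have massE z : reval H c (tick z s) (RLoad (mass_cell
    (NAdd (NMul (mask_of (var 2)) NNodes) (var 5)))) = agnostic_mass H S w.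
  rewrite /= l0 s2 s5 -/free tab; last first.
    have : (i %/ n < K)%N by rewrite ltn_divLR.
    by have := ltn_ord w; nia.
  rewrite /mass_value; congr (agnostic_mass _ _ _).
    by rewrite /maskM divnMDl // (divn_small (ltn_ord w)) addn0.
  by apply: val_inj; rewrite /= modnMDl modn_small.
have mSw z := mS z _ _ (ew z).
have mSv z := mS z _ _ (ev z).
have mS'w z := mS' z _ _ (ew z).
rewrite (activeE HP) stillE /factors exec_If equalE /= s4 s5.
have -> : (w == (j %% n)%N :> nat) = (w == u) by [].
have tt z z' : tick z (tick z' s) = tick (z' + z) s by rewrite /tick /= addnA.
case: (w == u).
  rewrite exec_If mS'w; case: (w \in S'); first by rewrite put_factorsE.
  rewrite !tt exec_If mSw; case: (boolP (w \in S)) => wS.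
    rewrite !tt exec_If mSv.
    by case: (v \in S); rewrite !tt put_factorsE // ?HE ?add0r ?addr0.
  rewrite !tt exec_If equalE ev ew.
  have -> : (w == v :> nat) = (w == v) by [].
  case: eqP => [wv|_].
    rewrite !tt put_factorsE //.
    have -> : (v \in S) = false by rewrite -wv (negbTE wS).
    by congr (upd (upd _ _ _) _ _); rewrite -(HE 0%N) -(massE 0%N).
  rewrite !tt exec_If mSv.
  by case: (v \in S); rewrite !tt put_factorsE // ?HE ?add0r ?addr0.
rewrite exec_If mSw; case: (w \in S).
  rewrite !tt exec_If mS'w; case: (w \in S') => /=; rewrite !tt put_factorsE //.
    by rewrite massE.
  by congr (upd (upd _ _ _) _ _); rewrite -(massE 0%N).
by rewrite !tt exec_If mS'w; case: (w \in S'); rewrite !tt put_factorsE.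
Qed.

Lemma coefficient_spec s m : layout c s ->
  nmem s 2%N = i -> nmem s 4%N = j -> mass_table (rmem s) ->
  let s' := exec H c coefficient s in
  (forall a, (a < free)%N || (free + 6 <= a)%N -> rmem s' a = rmem s a) /\
  reval H c s' (coefficient_value m) = transfer H m S S' u v.
Proof.
move=> lay s2 s4 tab s'.
pose A := extend 1 (active H S S' u v).
pose Z := extend 1 (fun w => (still S S' u v w)%:R).
pose I t r := [/\ forall a, (a < free)%N || (free + 6 <= a)%N -> r a = rmem s a,
  r (free + 0)%N = \prod_(k < t) A k,
  r (free + 1)%N = \sum_(k < t) A k * \prod_(l < t | (l : nat) != k) Z l,
  r (free + 2)%N = \prod_(k < t) Z k & r (free + 5)%N = t%:R].
have s'0 : nmem s' 0%N = D by rewrite keeps_exec //; case: lay.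
have s'sc a : neval c s' (scratch a) = (free + a)%N by rewrite /= s'0.
suff [out r0 r1 _ r5] : I n (rmem s').
  split=> //; case: m.
    rewrite transfer_sync [reval _ _ _ _]/= s'0 r0.
    by apply: eq_bigr => w _; rewrite /A extend_ord.
  rewrite transfer_async [reval _ _ _ _]/= s'0 r1 r5 mulrC; congr (_ * _).
  apply: eq_bigr => w _; rewrite /A extend_ord; congr (_ * _).
  by apply: eq_bigr => w' _; rewrite /Z extend_ord.
rewrite /s' /coefficient !exec_Seq; set s1 := exec H c (put 5 _) _.
have lay1 : layout c s1 by [].
apply: (for_rmem (I := I)) => [|t s'' tn s''5 fr [out r0 r1 r2 r5]].
  rewrite !rmem_RStore !scratchE //; split.
  - by move=> a ha; rewrite /upd !ifF //; apply/eqP => e; move: ha; rewrite e; lia.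
  - by rewrite /upd !eqn_add2l /= big_ord0.
  - by rewrite /upd !eqn_add2l /= big_ord0.
  - by rewrite /upd !eqn_add2l /= big_ord0.
  - by rewrite /upd eqxx.
have lay'' : layout c s''.
  apply: layout_frame lay1 => a ha; apply: fr.
  by have /= -> : (a != 5)%N by lia.
have s''2 : nmem s'' 2%N = i by rewrite fr.
have s''4 : nmem s'' 4%N = j by rewrite fr.
have tab'' : mass_table (rmem s'').
  by move=> k kN; rewrite out ?tab //; apply/orP; right; lia.
rewrite !exec_Seq.
have := factors_spec (w := Ordinal tn) lay'' s''2 s''4 s''5 tab''.
have nf : nmem (exec H c factors s'') 0%N = D by rewrite keeps_exec //; case: lay''.
move: nf; set s3 := exec H c factors s'' => s30 s3r.
rewrite /put /get; do 5 rewrite ?rmem_RStore ?nmem_RStore /=.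
rewrite s30 -/free s3r.
rewrite /I.
have At : A t = active H S S' u v (Ordinal tn) by exact: (extend_ord _ _ (Ordinal tn)).
have Zt : Z t = (still S S' u v (Ordinal tn))%:R by exact: (extend_ord _ _ (Ordinal tn)).
rewrite sum_prod_recr !big_ord_recr /= -r0 -r1 -r2 At Zt.
split.
- move=> a ha; rewrite -out // /upd.
  by rewrite !ifF //; apply/eqP => e; move: ha; rewrite e; lia.
- by rewrite /upd !eqn_add2l.
- by rewrite /upd !eqn_add2l.
- by rewrite /upd !eqn_add2l.
- by rewrite /upd !eqn_add2l /= r5; exact: natr1.
Qed.

End Entry.
Definition answer_row (b : nat) : R :=
  if b == 0%N then 1 else
  if (b.-1 %/ n == K.-1)%N && (input_state c (b.-1 %% n) == 1%N) then -1 else 0.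

Definition balance (m : mode) (i j : nat) : R :=
  if i == 0%N then (j %/ n == 0)%N%:R
  else (i == j)%N%:R - transfer H m (maskM i) (maskM j) (nodeM j) (nodeM i).

Definition system (m : mode) (a b : nat) : R :=
  if a == 0%N then answer_row b else if b == 0%N then 0 else
  if b == D then (a == 1)%N%:R else balance m a.-1 b.-1.

Lemma mass_table_upd r a x : (a < free)%N -> mass_table r -> mass_table (upd r a x).
Proof. by move=> af tab i iN; rewrite /upd ifF ?tab //; apply/eqP; lia. Qed.

Lemma target_lt i j : (i < K * n)%N -> (j < K * n)%N ->
  ((i + 1) * (D + 1) + (j + 1) < free)%N.
Proof.
move=> iN jN; rewrite /free; have -> : D = (K * n).+1 by [].
by move: (K * n)%N iN jN => N; nia.
Qed.

Lemma write_answer_row_spec s : layout c s ->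
  (forall a, (a < free)%N -> rmem s a = 0) -> mass_table (rmem s) ->
  let r := rmem (exec H c write_answer_row s) in
  stores_rows r D (fun a b => if a == 0%N then answer_row b else 0) /\ mass_table r.
Proof.
move=> lay r0 tab /=; rewrite exec_Seq; set s1 := exec H c (RStore _ _) s.
have D0 : (0 < D)%N by [].
have free0 : (0 < free)%N by rewrite /free; nia.
have lay1 : layout c s1 by [].
pose row t b : R := if b == 0%N then 1 else
  if [&& (b.-1 %/ n == K.-1)%N, (b.-1 %% n < t)%N & input_state c (b.-1 %% n) == 1%N]
  then -1 else 0.
pose I t r := stores_rows r D (fun a b => if a == 0%N then row t b else 0) /\
  mass_table r.
have : I n (rmem (exec H c (For (NConst 5) NNodes
         (If (equal (NState (var 5)) (NConst 1))
             (RStore (NAdd (NConst 1)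
                        (NAdd (NMul (NSub (var 1) (NConst 1)) NNodes) (var 5)))
                     (RSub (RConst 0) (RConst 1)))
             Skip)) s1)).
  apply: (for_rmem (I := I)) => [|t s' /= tn s'5 fr [st tab']].
    split; last exact: mass_table_upd.
    have st0 : stores_rows (rmem s) D (fun _ _ => 0).
      by move=> a b aD bD; rewrite r0 // entry_lt.
    have := stores_rows_upd 0 1 (leq0n D) st0; apply: stores_rows_ext => a b _ _.
    by rewrite /row ltn0 andbF; case: (a == 0%N); case: (b == 0%N).
  rewrite exec_If equalE /= s'5; case: eqP => red; last first.
    rewrite exec_Skip; split=> //=; apply: stores_rows_ext st => a b _ _.
    rewrite /row; case: eqP => // _; case: eqP => // _; rewrite ltnS ltn_neqAle.
    by case: (b.-1 %% n =P t)%N => [->|//] /=; rewrite (introF eqP red) !andbF.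
  have l1 : nmem s' 1%N = K by rewrite fr //; case: lay1.
  rewrite rmem_RStore /= l1 s'5.
  set b0 := (1 + _)%N.
  have K0 : (0 < K)%N := masks_gt0 c.
  have bE : b0 = ((K - 1) * n + t).+1 by [].
  have b0D : (b0 <= D)%N by rewrite bE /D /system_size -/K; nia.
  split; last by apply: mass_table_upd => //; rewrite /free; nia.
  have -> : b0 = (0 * (D + 1) + b0)%N by [].
  have := stores_rows_upd 0 (0 - 1) b0D st; apply: stores_rows_ext => a b _ _.
  case: (a =P 0%N) => //= _; rewrite /row; case: (b =P b0) => [->|bb0].
    rewrite bE /= divnMDl // modnMDl divn_small // modn_small // addn0 subn1 eqxx.
    by rewrite ltnSn red /= sub0r.
  case: eqP => // b1; rewrite ltnS [(_ < t)%N]ltn_neqAle.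
  case: (b.-1 %% n =P t)%N => [mt|//] /=; rewrite andbF.
  rewrite [in RHS]ifF //; apply/negP => /andP[/eqP q _]; apply: bb0.
  by rewrite bE subn1 -q -mt -divn_eq prednK // lt0n; apply/eqP.
case=> st tab'; split=> //; apply: stores_rows_ext st => a b _ _.
by rewrite /row /answer_row ltn_pmod.
Qed.

Lemma write_balances_spec s m : layout c s ->
  stores_rows (rmem s) D (fun a b => if a == 0%N then answer_row b else 0) ->
  mass_table (rmem s) ->
  stores_rows (rmem (exec H c (write_balances m) s)) D
    (fun a b => if (a != 0%N) && (b == D) then 0 else system m a b).
Proof.
move=> lay st tab.
(* The balances written so far are those before [(i, j)] in lexicographic order; the right-hand
   column is still zero below row 0. *)
pose M i j a b : R := if a == 0%N then answer_row b else
  if (b == 0%N) || (b == D) then 0 else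
  if (a.-1 < i)%N || (a.-1 == i) && (b.-1 < j)%N then balance m a.-1 b.-1 else 0.
have DE : D = (K * n).+1 by [].
have unkE s' : layout c s' -> neval c s' unknowns = (K * n)%N.
  by case=> l0 _ _; rewrite /= l0 subn1.
pose I i r := stores_rows r D (M i 0%N) /\ mass_table r.
have : I (K * n)%N (rmem (exec H c (write_balances m) s)).
  rewrite -(unkE _ lay); apply: (for_rmem (I := I)) => [|i s1 iN s12 fr [st1 tab1]].
    split=> //; apply: stores_rows_ext st => a b _ _.
    by rewrite /M !ltn0 andbF; case: ifP => //; case: ifP.
  rewrite unkE // in iN.
  have lay1 : layout c s1.
    apply: layout_frame lay => a ha; apply: fr.
    have h2 : (a != 2)%N by lia.
    have h4 : (a != 4)%N by lia.
    have h5 : (a != 5)%N by lia.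
    by rewrite /= h2 h4 h5.
  pose J j r := stores_rows r D (M i j) /\ mass_table r.
  have : J (K * n)%N (rmem (exec H c (For (NConst 4) unknowns
      (If (NLe (var 2) (NConst 0))
        (If (NLe (mask_of (var 4)) (NConst 0))
            (RStore (entry (NAdd (var 2) (NConst 1)) (NAdd (var 4) (NConst 1))) (RConst 1))
            (RStore (entry (NAdd (var 2) (NConst 1)) (NAdd (var 4) (NConst 1))) (RConst 0)))
        (Seq coefficient
          (If (equal (var 2) (var 4))
            (RStore (entry (NAdd (var 2) (NConst 1)) (NAdd (var 4) (NConst 1)))
              (RSub (RConst 1) (coefficient_value m)))
            (RStore (entry (NAdd (var 2) (NConst 1)) (NAdd (var 4) (NConst 1)))
              (RSub (RConst 0) (coefficient_value m))))))) s1)).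
    rewrite -(unkE _ lay1); apply: (for_rmem (I := J)) => [//|j s2 jN s24 fr2 [st2 tab2]].
    rewrite unkE // in jN.
    have lay2 : layout c s2.
      apply: layout_frame lay1 => a ha; apply: fr2.
      have h4 : (a != 4)%N by lia.
      have h5 : (a != 5)%N by lia.
      by rewrite /= h4 h5.
    have s22 : nmem s2 2%N = i by rewrite fr2.
    have targetE s3 : nmem s3 0%N = D -> nmem s3 2%N = i -> nmem s3 4%N = j ->
        neval c s3 (entry (NAdd (var 2) (NConst 1)) (NAdd (var 4) (NConst 1))) =
        ((i + 1) * (D + 1) + (j + 1))%N by move=> /= -> -> ->.
    (* Every branch ends by storing one value in the target entry, so a single lemma on that store
       advances the invariant. *)
    suff write r x : stores_rows r D (M i j) -> mass_table r -> x = balance m i j ->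
        J j.+1 (upd r ((i + 1) * (D + 1) + (j + 1))%N x).
      have l20 : nmem s2 0%N = D by case: lay2.
      rewrite exec_If /= s22 leqn0; case: eqP => i0.
        rewrite exec_If /= s24 leqn0.
        by case: eqP => j0; rewrite rmem_RStore targetE //; apply: write => //;
          rewrite /balance i0 /= ?(introT eqP j0) ?(introF eqP j0).
      rewrite exec_Seq; set s3 := exec H c coefficient _.
      have k3 a : a != 5%N -> nmem s3 a = nmem s2 a.
        by move=> a5; rewrite keeps_exec //= a5.
      have [out val] : (forall a, (a < free)%N || (free + 6 <= a)%N -> rmem s3 a = rmem s2 a) /\
          reval H c s3 (coefficient_value m) = transfer H m (maskM i) (maskM j) (nodeM j) (nodeM i).
        exact: coefficient_spec.
      have st3 : stores_rows (rmem s3) D (M i j).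
        by move=> a b aD bD; rewrite out ?st2 // entry_lt.
      have tab3 : mass_table (rmem s3).
        by move=> k kN; rewrite out ?tab2 //; apply/orP; right; lia.
      rewrite exec_If equalE /= !k3 // s22 s24.
      have valt z : reval H c (tick z s3) (coefficient_value m) =
          transfer H m (maskM i) (maskM j) (nodeM j) (nodeM i) by rewrite -val; case: (m).
      by case: eqP => ij; rewrite rmem_RStore targetE ?[nmem _ _]k3 //; apply: write => //;
        rewrite /balance (introF eqP i0) [reval _ _ _ _]/= ?(introT eqP ij) ?(introF eqP ij) valt.
    move=> st3 tab3 xE; split; last by apply: mass_table_upd => //; exact: target_lt.
    have jD : (j + 1 <= D)%N by lia.
    have := stores_rows_upd (i + 1) x jD st3; apply: stores_rows_ext => a b _ _.
    rewrite xE /M; case: a => [|a] /=; first by rewrite addn1.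
    case: b => [|b] /=; first by rewrite !addn1 /= andbF.
    rewrite !addn1 !eqSS ltnS [(b <= j)%N]leq_eqVlt.
    case: (a =P i) => [->|ai] //=; rewrite ltnn /=.
    case: (b =P j) => [->|bj] //=; rewrite ifF //; apply/eqP; lia.
  case=> st2 tab2; split=> //; apply: stores_rows_ext st2 => a b _ bD.
  rewrite /M; case: eqP => // a0; case: ifP => // b0.
  have -> : (b.-1 < K * n)%N by lia.
  by congr (if _ then _ else _); lia.
case=> + _; apply: stores_rows_ext => a b aD bD; rewrite /M /system.
case: (a =P 0%N) => //= a0; case: (b =P D) => //= bD'; first by rewrite orbT.
rewrite orbF; case: eqP => // b0.
by have -> : (a.-1 < K * n)%N by lia.
Qed.

Lemma write_system_spec s m : layout c s -> rmem s = (fun=> 0) ->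
  let s' := exec H c (write_system m) s in
  nmem s' 0%N = D /\ stores_rows (rmem s') D (system m).
Proof.
move=> lay r0; rewrite /write_system !exec_Seq.
have keep p s0 : keeps 0 p -> keeps 1 p -> (forall v, keeps (10 + v) p) ->
    layout c s0 -> layout c (exec H c p s0).
  move=> k0 k1 kv; apply: layout_frame => -[|[|a]] // ha; rewrite keeps_exec //.
  by have -> : a.+2 = (10 + (a.+2 - 10))%N by lia.
have [low tab] := write_masses_spec lay.
have := keep write_masses s isT isT (fun=> isT) lay.
move: low tab; set s1 := exec H c write_masses s => low tab lay1.
have r1 a : (a < free)%N -> rmem s1 a = 0 by move=> af; rewrite low ?r0 //; lia.
have := keep write_answer_row s1 isT isT (fun=> isT) lay1.
have := write_answer_row_spec lay1 r1 tab.
set s2 := exec H c write_answer_row s1 => -[st2 tab2] lay2.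
have := write_balances_spec m lay2 st2 tab2.
have [] : layout c (exec H c (write_balances m) s2) by apply: keep.
set s3 := exec H c (write_balances m) s2 => l0 _ _ st3.
split=> //; rewrite rmem_RStore /= l0.
have := stores_rows_upd 1 1 (leqnn D) st3; apply: stores_rows_ext => a b aD bD.
rewrite /system; case: (a =P 1%N) => [->|a1] /=; case: (b =P D) => [->|] //=.
  by rewrite andbT; case: eqP.
by rewrite andbF.
Qed.

Lemma write_system_bounded m : bounded n D (footprint_bound c) (write_system m).
Proof.
have nD : (n <= D)%N by rewrite /D /system_size ltnW // ltnS leq_pmull // masks_gt0.
have nDD : (D * n <= D * D)%N by rewrite leq_mul2l nD orbT.
rewrite /footprint_bound -/D expnS expn1 /=.
by case: m => /=; repeat split; lia.
Qed.

Lemma gauss_jordan_bounded : bounded n D (footprint_bound c) gauss_jordan.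
Proof.
rewrite /footprint_bound -/D expnS expn1 /=.
by repeat split; lia.
Qed.

End System.

(** * Correctness of the linear system *)

Section Correctness.
Variables (R : realType) (n : nat) (E : rel 'I_n) (H : 'M[R]_n) (c : config n).
Variable m : mode.
Hypotheses (n_gt0 : (0 < n)%N) (connE : strongly_connected E).
Hypothesis HP : transition_matrix E H.

Let K := masks c.
Let D := system_size c.
Let nodeM := node n_gt0.
Let maskM i := mask_set c (i %/ n).

(** Inverse of [mask_set] on the subsets of the agnostic set; 0 is a default elsewhere. *)
Definition mask_code (S : {set 'I_n}) : nat :=
  if [pick s : 'I_K | mask_set c s == S] is Some s then s else 0%N.

Lemma mask_codeK s : (s < K)%N -> mask_code (mask_set c s) = s.
Proof.
move=> sK; rewrite /mask_code; case: pickP => [s' /eqP e|/(_ (Ordinal sK))].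
  exact: (mask_set_inj n_gt0 (ltn_ord s') sK e).
by rewrite eqxx.
Qed.

Definition unknown (x : nat -> R) (S : {set 'I_n}) (v : 'I_n) : R :=
  x (mask_code S * n + v).+1.

Lemma unknownE x j : (j < K * n)%N -> unknown x (maskM j) (nodeM j) = x j.+1.
Proof.
by move=> jN; rewrite /unknown mask_codeK ?ltn_divLR //= -divn_eq.
Qed.

Lemma sum_unknown x (G : {set 'I_n} -> 'I_n -> R) :
  \sum_(j < K * n) G (maskM j) (nodeM j) * x j.+1 =
  \sum_(S : {set 'I_n} | S \subset agnostic c) \sum_u G S u * unknown x S u.
Proof.
rewrite -(sum_states c n_gt0 (fun S u => G S u * unknown x S u)).
by apply: eq_bigr => j _; rewrite unknownE.
Qed.

Lemma mask_eq s s' : (s < K)%N -> (s' < K)%N ->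
  (s == s') = (mask_set c s == mask_set c s').
Proof.
by move=> sK s'K; apply/eqP/eqP => [->//|]; exact: (mask_set_inj n_gt0).
Qed.

(** Row 0 yields the potential, row 1 the normalization, and the other rows the balances. Used with
    [beta = 0] for regularity and [beta = 1] for the solution. *)
Lemma system_layer (x : nat -> R) (beta : R) :
  (forall a, (a < D)%N ->
     \sum_(b < D) system H c n_gt0 m a b * x b = beta * (a == 1)%N%:R) ->
  layer_solution H m (agnostic c) (nodeM 0) (unknown x) beta /\
  x 0%N = potential (unknown x) c.
Proof.
move=> eqs.
have K0 : (0 < K)%N := masks_gt0 c.
have nodeE s (v : 'I_n) : nodeM (s * n + v) = v.
  by apply: val_inj; rewrite /= modnMDl modn_small.
have maskE s (v : 'I_n) : maskM (s * n + v) = mask_set c s.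
  by rewrite /maskM divnMDl // (divn_small (ltn_ord v)) addn0.
have rowS i : (i < K * n)%N ->
    \sum_(j < K * n) balance H c n_gt0 m i j * x j.+1 = beta * (i == 0)%N%:R.
  move=> iN; rewrite -eqSS -eqs // [RHS]big_ord_recl mul0r add0r.
  apply: eq_bigr => j _; rewrite lift0 /system /= ifF //.
  by rewrite eqSS ltn_eqF.
split; last first.
  have := eqs 0%N isT; rewrite mulr0 big_ord_recl mul1r => /eqP.
  rewrite addrC addr_eq0 => /eqP e; rewrite -[LHS]opprK -e -sumrN.
  transitivity (\sum_(j < K * n)
     ((maskM j == agnostic c) && (c (nodeM j) == Some true))%:R * x j.+1).
    apply: eq_bigr => j _; rewrite lift0 /system /answer_row /= -(mask_set_full c n_gt0).
    have -> : (input_state c (j %% n) == 1%N) = (c (nodeM j) == Some true).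
      exact: (input_state_red c (nodeM j)).
    rewrite -mask_eq ?prednK // ?ltn_divLR //.
    by case: ifP; rewrite ?mul1r ?mul0r ?mulN1r ?opprK ?oppr0.
  rewrite (sum_unknown x (fun S u => ((S == agnostic c) && (c u == Some true))%:R)).
  rewrite (bigD1 (agnostic c)) //= [X in _ + X]big1 ?addr0 => [|S /andP[_ /negbTE SA]].
    rewrite /potential [RHS]big_mkcond; apply: eq_bigr => u _; rewrite eqxx /=.
    by case: ifP; rewrite ?mul1r ?mul0r.
  by apply: big1 => u _; rewrite SA mul0r.
split.
- move=> S v SA neq; have [s sK sS] := mask_set_onto n_gt0 SA.
  set i := (s * n + v)%N.
  have iN : (i < K * n)%N by rewrite /i; have := ltn_ord v; nia.
  have i0 : (i == 0%N) = false.
    apply/negbTE; apply: contra neq => /eqP e.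
    have -> : v = nodeM 0 by rewrite -(nodeE s v) -/i e.
    by rewrite xpair_eqE eqxx andbT -sS -(maskE s v) -/i e /maskM div0n mask_set0.
  have := rowS i iN; rewrite i0 mulr0 /balance i0.
  under eq_bigr => j _ do rewrite mulrBl.
  rewrite sumrB; move/subr0_eq.
  rewrite (bigD1 (Ordinal iN)) //= eqxx mul1r big1 ?addr0 => [|j ji]; last first.
    by rewrite -val_eqE /= in ji; rewrite eq_sym (negbTE ji) mul0r.
  rewrite -(unknownE x iN) /balanced.
  have -> : mask_set c (i %/ n) = S by rewrite -sS -(maskE s v).
  have -> : node n_gt0 i = v by exact: nodeE.
  have -> : maskM i = S by rewrite -sS -(maskE s v).
  have -> : nodeM i = v by exact: nodeE.
  move=> ->.
  exact: (sum_unknown x (fun S' u => transfer H m S S' u v)).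
- have := rowS 0%N; rewrite muln_gt0 n_gt0 K0 => /(_ isT); rewrite eqxx mulr1 => <-.
  transitivity (\sum_(j < K * n) (maskM j == set0)%:R * x j.+1).
    rewrite (sum_unknown x (fun S u => (S == set0)%:R)) (bigD1 set0) ?sub0set //=.
    rewrite [X in _ + X]big1 ?addr0 => [|S /andP[_ /negbTE S0]].
      by apply: eq_bigr => u _; rewrite eqxx mul1r.
    by apply: big1 => u _; rewrite S0 mul0r.
  apply: eq_bigr => j _; rewrite /balance /= -(mask_set0 c) -mask_eq ?ltn_divLR //.
Qed.

Definition system_matrix : 'M[R]_D := \matrix_(a, b) system H c n_gt0 m a b.
Definition system_rhs : 'cV[R]_D := \col_a system H c n_gt0 m a D.

Lemma system_rhsE (a : 'I_D) : system_rhs a 0 = (a == 1 :> nat)%N%:R.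
Proof.
rewrite mxE /system eqxx /= /answer_row; case: (a =P 0%N :> nat) => // ->.
(* In row 0, column [D] decodes to the mask [masks c], one past the last, so the right-hand side
   there is 0. *)
rewrite /D /system_size /= mulnK //.
by rewrite gtn_eqF // prednK // masks_gt0.
Qed.

Lemma system_matrixE (x : 'cV[R]_D) (beta : R) :
  system_matrix *m x = beta *: system_rhs -> forall a, (a < D)%N ->
  \sum_(b < D) system H c n_gt0 m a b * x (inord b) 0 = beta * (a == 1)%N%:R.
Proof.
move=> e a aD; have /matrixP/(_ (Ordinal aD) 0) := e.
rewrite !mxE -/(system_rhs) => {e}; have := system_rhsE (Ordinal aD); rewrite mxE => -> <-.
by apply: eq_bigr => b _; rewrite mxE inord_val.
Qed.

(** A kernel vector is a layer solution with [beta = 0]: its layers vanish by [layer_kernel], and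
    then so does its coordinate 0, which is their potential. *)
Lemma system_matrix_unit : system_matrix \in unitmx.
Proof.
rewrite -unitmx_tr -row_free_unit; apply: inj_row_free => v vA.
have e : system_matrix *m v^T = 0 *: system_rhs.
  by rewrite scale0r -[LHS]trmxK trmx_mul trmxK vA trmx0.
pose x b := v^T (inord b) 0.
have [sol x0] := @system_layer x 0 (system_matrixE e).
have ker := layer_kernel n_gt0 connE HP sol.
apply/matrixP => i a; rewrite ord1 [RHS]mxE.
have -> : v 0 a = x a by rewrite /x mxE inord_val.
case: a => -[|j] aD /=.
  by rewrite x0 /potential big1 // => u _; rewrite ker.
have jN : (j < K * n)%N by [].
by rewrite -(unknownE x jN) ker // mask_set_sub // ltn_divLR.
Qed.

End Correctness.

(** * Assembly of correctness, running time and memory *)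

Theorem theorem9 (m : mode) :
  exists (build solve : cmd) (C : nat),
    linear_solver solve /\
    forall (R : realType) (n : nat) (E : rel 'I_n) (H : 'M[R]_n)
           (d : measure_display) (T : measurableType d) (P : probability T R)
           (xi : nat -> T -> choices m n) (c : config n),
      (0 < n)%N ->
      strongly_connected E ->
      transition_matrix E H ->
      iid_with_law P xi (choices_law H) ->
      converges P xi ->
      let k := #|agnostic c| in
      let built := exec H c build (machine0 R) in
      let final := exec H c solve built in
      [/\ exists (N : nat) (A : 'M[R]_N.+1) (b : 'cV[R]_N.+1),
            [/\ (N.+1 <= C * (n * 2 ^ k))%N,
                A \in unitmx,
                stores_system built A b
              & forall x : 'cV[R]_N.+1, A *m x = b ->
                  (x ord0 0)%:E = red_consensus_prob P xi c],
          (rmem final 0)%:E = red_consensus_prob P xi c,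
          (elapsed final <= C * (n ^ 3 * 2 ^ (3 * k)))%N
        & (footprint final <= C * (n ^ 2 * 2 ^ (2 * k)))%N].
Proof.
set W := (weight write_weights + weight (write_system m) + weight gauss_jordan)%N.
(* Since [D.+1] is at most [3 * (K * n)], the memory bound needs the constant [10 * 3 ^ 2 = 90] and
   the time bound [3 ^ 3 * W]. *)
exists (build_system m), gauss_jordan, (90 * W.+1)%N; split; first exact: gauss_jordan_solver.
move=> R n E H d T P xi c n_gt0 connE HP iid conv k built final.
pose K := masks c; pose D := system_size c.
have K0 : (0 < K)%N := masks_gt0 c.
have DE : D = (K * n).+1 by [].
have Kn0 : (0 < K * n)%N by rewrite muln_gt0 K0.
have [lay r0 nD fp el] := write_weights_spec H c n_gt0.
have [d0 st] := write_system_spec n_gt0 HP m lay r0.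
have [bD bfp bel] := bounded_exec H c (write_system_bounded c n_gt0 m) nD.
have := bounded_exec H c (gauss_jordan_bounded c n_gt0) bD.
rewrite -exec_Seq -/(build_system m) -/built -/final in d0 st bD bfp bel *.
move=> [_ ffp fel].
have unitA := system_matrix_unit c m n_gt0 connE HP.
have stored : stores_system built (system_matrix H c m n_gt0) (system_rhs H c m n_gt0).
  split=> [|i j|i]; first exact: d0.
    by rewrite -addn1 st ?mxE // ltnW.
  by rewrite -addn1 st ?mxE.
have sol x : system_matrix H c m n_gt0 *m x = system_rhs H c m n_gt0 ->
    (x ord0 0)%:E = red_consensus_prob P xi c.
  rewrite -[system_rhs _ _ _]scale1r => e.
  pose y b := x (inord b) 0.
  have [lsol y0] := @system_layer _ _ H c m n_gt0 y 1 (system_matrixE e).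
  rewrite -(red_consensus_potential n_gt0 HP iid conv lsol) -y0 /y.
  by congr (x _ _)%:E; apply: val_inj; rewrite /= inordK.
have powK e : (2 ^ (e * k) = K ^ e)%N by rewrite mulnC expnM.
have size_le : (D.+1 <= 3 * (K * n))%N by rewrite DE; lia.
have pow_le e : (D.+1 ^ e <= 3 ^ e * (n ^ e * 2 ^ (e * k)))%N.
  rewrite powK -expnMn -expnMn [(n * K)%N]mulnC.
  by case: e => // e; rewrite leq_exp2r.
split.
- exists (K * n)%N, (system_matrix H c m n_gt0), (system_rhs H c m n_gt0); split=> //.
  have -> : (2 ^ k = K)%N by [].
  by rewrite [(n * K)%N]mulnC; move: (K * n)%N (W) Kn0 => a w a0; nia.
- have [x [xe xs]] := gauss_jordan_solver H c unitA stored.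
  by rewrite -(sol x xe) -xs.
- have depth_write : depth (write_system m) = 3 by case: (m).
  have depth_solve : depth gauss_jordan = 3 by [].
  have el3 : (weight write_weights * n.+1 <= weight write_weights * D.+1 ^ 3)%N.
    have nD' : (n.+1 <= D.+1)%N by rewrite DE; nia.
    by rewrite leq_mul2l (leq_trans nD') ?orbT // -[leqLHS]expn1 leq_pexp2l.
  have total : (elapsed final <= W * D.+1 ^ 3)%N.
    rewrite (leq_trans fel) // depth_solve -/D /W mulnDl leq_add2r.
    rewrite (leq_trans bel) // depth_write -/D mulnDl leq_add2r.
    exact: leq_trans el el3.
  rewrite (leq_trans total) // (leq_trans (leq_mul (leqnn W) (pow_le 3))) //.
  by rewrite mulnA leq_mul2r [(_ <= _)%N](_ : _ = true) ?orbT //; lia.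
- have F_le : (footprint_bound c <= 90 * W.+1 * (n ^ 2 * 2 ^ (2 * k)))%N.
    rewrite /footprint_bound -/D (leq_trans (leq_mul (leqnn 10) (pow_le 2))) //.
    by rewrite mulnA leq_mul2r [(_ <= _)%N](_ : _ = true) ?orbT //; lia.
  by rewrite (leq_trans _ F_le) // (leq_trans ffp) // geq_max leqnn andbT
    (leq_trans bfp) // geq_max fp leqnn.
Qed.
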